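(* Let $\kappa_0\ge1$ be fixed and assume $\kappa\le\kappa_0$. Let $c_2,c_3,c_\lambda>0$ be constants. There is a constant $c_0>0$ such that if $p\ge\frac{c_0\log n}{n}$, $L\le c_2 n^{c_3}$ and $\lambda=c_\lambda\sqrt{\frac{np\log n}{L}}$, then with probability at least $1-O(n^{-5})$ the regularized MLE $\theta$ satisfies $$\frac{\big\|e^{\theta}-e^{\theta^*-\bar\theta^*\mathbf 1}\big\|_\infty}{\big\|e^{\theta^*-\bar\theta^*\mathbf 1}\big\|_\infty}\le C\sqrt{\frac{\log n}{npL}},$$ where $\bar\theta^*=\frac1n\mathbf 1^\top\theta^*$, $e^{v}$ denotes the entrywise exponential of a vector $v$, and $C$ depends only on $\kappa_0,c_2,c_3,c_\lambda$.
   Context: Bradley–Terry–Luce (BTL) setup. There are $n$ items with unknown preference scores $w_1^*\ge w_2^*\ge\cdots\ge w_n^*>0$, all lying in $[w_{\min},w_{\max}]$ with $w_{\min}>0$; set $\theta_i^*=\log w_i^*$ and $\kappa=w_{\max}/w_{\min}$. A comparison graph $\mathcal G=(\{1,\dots,n\},\mathcal E)$ is drawn from the Erdős–Rényi model $\mathcal G_{n,p}$ (each unordered pair is an edge independently with probability $p$). For each edge $(i,j)\in\mathcal E$ one observes $L$ comparisons $y_{i,j}^{(l)}$, $l=1,\dots,L$, where $y_{i,j}^{(l)}=1$ with probability $y^*_{i,j}:=\frac{w_j^*}{w_i^*+w_j^*}$ and $0$ otherwise, with the convention $y_{j,i}^{(l)}=1-y_{i,j}^{(l)}$; all comparisons are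 mutually independent and independent of $\mathcal G$. Let $y_{i,j}=\frac1L\sum_{l=1}^L y_{i,j}^{(l)}$. Regularized MLE: with $\mathcal L(\theta;y)=\sum_{(i,j)\in\mathcal E,\,i>j}\{-y_{j,i}(\theta_i-\theta_j)+\log(1+e^{\theta_i-\theta_j})\}$ and $\mathcal L_\lambda(\theta;y)=\mathcal L(\theta;y)+\frac\lambda2\|\theta\|_2^2$, the regularized MLE $\theta$ is the minimizer of $\mathcal L_\lambda(\cdot;y)$ over $\mathbb R^n$. *)

(* Defs.v *)
From Stdlib Require Import Reals ClassicalEpsilon.
From mathcomp Require Import all_boot.
Set Implicit Arguments. Unset Strict Implicit. Unset Printing Implicit Defensive.

Local Open Scope R_scope.

Notation "\Rsum_ ( i : T | P ) F" := (\big[Rplus/R0]_(i : T | P) F)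
  (at level 41, F at level 41, i, T at level 50).
Notation "\Rsum_ ( i : T ) F" := (\big[Rplus/R0]_(i : T) F)
  (at level 41, F at level 41, i, T at level 50).
Notation "\Rprod_ ( i : T ) F" := (\big[Rmult/R1]_(i : T) F)
  (at level 36, F at level 36, i, T at level 50).

(* One outcome of the whole random experiment on n items with L comparisons per
   edge.  For a pair (i,j) with j < i (0-based indices):
     - (o.1 i j) is the indicator that (i,j) is an edge of G ~ G_{n,p};
     - (o.2 i j l) is the l-th comparison outcome y_{i,j}^{(l)}, equal to 1 with
       probability w_j/(w_i+w_j).
   Comparisons are drawn for every pair independently of G (only those on edges
   are used); coordinates for pairs with not (j < i) are unused and are forced
   to be false (probability one). *)
Definition outcome (n L : nat) : finType :=
  ({ffun 'I_n -> {ffun 'I_n -> bool}} *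
   {ffun 'I_n -> {ffun 'I_n -> {ffun 'I_L -> bool}}})%type.

Definition bern (q : R) (b : bool) : R := if b then q else 1 - q.

Definition weight (n L : nat) (w : 'I_n -> R) (p : R) (o : outcome n L) : R :=
  \Rprod_(i : 'I_n) \Rprod_(j : 'I_n)
    (if (j < i)%N then
       bern p (o.1 i j) *
       \Rprod_(l : 'I_L) bern (w j / (w i + w j)) (o.2 i j l)
     else
       (if o.1 i j then 0 else 1) *
       \Rprod_(l : 'I_L) (if o.2 i j l then 0 else 1)).

Definition prob (n L : nat) (w : 'I_n -> R) (p : R) (E : outcome n L -> Prop) : R :=
  \Rsum_(o : outcome n L)
    (if excluded_middle_informative (E o) then weight w p o else 0).

Definition ybar (n L : nat) (o : outcome n L) (i j : 'I_n) : R :=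
  (\Rsum_(l : 'I_L) (if o.2 i j l then 1 else 0)) / INR L.

(* regularized negative log-likelihood L_lambda(theta; y); for i > j,
   y_{j,i} = 1 - y_{i,j} *)
Definition Lreg (n L : nat) (o : outcome n L) (lam : R) (theta : 'I_n -> R) : R :=
  \Rsum_(i : 'I_n) \Rsum_(j : 'I_n | (j < i)%N && o.1 i j)
     (- (1 - ybar o i j) * (theta i - theta j) + ln (1 + exp (theta i - theta j)))
  + lam / 2 * \Rsum_(i : 'I_n) (theta i ^ 2).

Definition is_regMLE (n L : nat) (o : outcome n L) (lam : R) (theta : 'I_n -> R) : Prop :=
  forall theta' : 'I_n -> R, Lreg o lam theta <= Lreg o lam theta'.

Definition supnorm (n : nat) (v : 'I_n -> R) : R :=
  \big[Rmax/R0]_(i : 'I_n) Rabs (v i).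

Definition centered_exp (n : nat) (w : 'I_n -> R) : 'I_n -> R :=
  fun i => exp (ln (w i) - (\Rsum_(k : 'I_n) ln (w k)) / INR n).

(* Main.v *)
(** Write theta for the regularized MLE, theta* for the centred true scores, a = n p,
    B = sqrt (a log n / L), delta = theta - theta* and D = max |delta|.  The gradient of the noise
    is O(B) in every coordinate and lambda is of order B, so at an extremal coordinate of delta the
    penalty alone bounds theta by a constant.  Hence all logistic slopes are bounded below, and the
    stationarity equations behave like a Laplacian system.  Every cut of the graph (and of the graph
    without one item) is at least a quarter of its mean, which gives a spectral gap of order a by
    Cheeger's argument, hence an average error |delta|_2 / sqrt n of order B / a.
    For the sup norm, let m maximise |delta| and let x be the minimiser for the data without item m.
    The perturbation of the equations of the other items caused by item m has l2 norm
    O(sqrt a D + B), so |theta - x|_2 = O(D / sqrt a + B / a).  In row m, D is bounded by the mean of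
    |delta_j| over the neighbours j of m.  Replacing theta by x there costs little, and since x is
    independent of the edges at m, that sum is at most 2 p |x - theta*|_1 + 8 log n |x - theta*|_oo.
    The first term is O(B) by the l2 bound, and the second is a small multiple of a D when c0 is
    large, so that D = O(B / a). *)
Require Import Defs.
From Stdlib Require Import Reals ClassicalEpsilon.
From mathcomp Require Import all_boot.
From HB Require Import structures.
From Stdlib Require Import Lra Psatz.
Set Implicit Arguments. Unset Strict Implicit. Unset Printing Implicit Defensive.
Local Open Scope R_scope.

(** * Real-valued finite sums *)

(** The maximiser m of |delta| depends on the data, so a solution x is fixed beforehand for every m,
    and its bound over the edges at m is demanded for all m at once. Theta cannot take its place: it
    depends on the edges at m, so no concentration bound applies to its error summed over them. All
    random requirements are packed into one function [badness], a sum of normalised exponential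
    moments. A nonnegative sum below 1 has every term below 1, and a term exp(X - t) below 1 means X
    < t; Markov's inequality for [badness] thus does the union bound as well. The exponents are
    tuned so that each moment has mean at most n^-8. Cuts are the exception: there are exponentially
    many vertex sets S, so the cut of S has to cost n^(-8|S|). Everything after that is
    deterministic, for an arbitrary symmetric relation and win frequencies. The bound on D is
    self-referential: D returns on the right-hand side, and c0 is chosen so that its total
    coefficient there is at most half of the one on the left. *)

Fact RplusA : associative Rplus. Proof. by move=> x y z; rewrite Rplus_assoc. Qed.
Fact RmultA : associative Rmult. Proof. by move=> x y z; rewrite Rmult_assoc. Qed.
HB.instance Definition _ :=
  Monoid.isComLaw.Build R R0 Rplus RplusA Rplus_comm Rplus_0_l.
HB.instance Definition _ :=
  Monoid.isComLaw.Build R R1 Rmult RmultA Rmult_comm Rmult_1_l.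
HB.instance Definition _ :=
  Monoid.isMulLaw.Build R R0 Rmult Rmult_0_l Rmult_0_r.
HB.instance Definition _ :=
  Monoid.isAddLaw.Build R Rmult Rplus Rmult_plus_distr_r Rmult_plus_distr_l.

Section Sums.
Variable I : finType.
Implicit Types (P : pred I) (F G : I -> R) (c : R).

Lemma Rsum_ge0 P F : (forall i, P i -> 0 <= F i) -> 0 <= \Rsum_(i : I | P i) F i.
Proof. by move=> h; apply: big_ind => //; [lra | move=> x y; lra]. Qed.

Lemma Rsum_le P F G : (forall i, P i -> F i <= G i) ->
  \Rsum_(i : I | P i) F i <= \Rsum_(i : I | P i) G i.
Proof.
move=> h; apply: (big_ind2 (fun x y => x <= y)) => //; first lra.
by move=> x1 x2 y1 y2; lra.
Qed.

Lemma Rsum_mull c P F : \Rsum_(i : I | P i) (c * F i) = c * \Rsum_(i : I | P i) F i.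
Proof. by rewrite big_distrr. Qed.

Lemma Rsum_mulr c P F : \Rsum_(i : I | P i) (F i * c) = (\Rsum_(i : I | P i) F i) * c.
Proof. by rewrite big_distrl. Qed.

Lemma Rsum_add P F G : \Rsum_(i : I | P i) (F i + G i) =
  \Rsum_(i : I | P i) F i + \Rsum_(i : I | P i) G i.
Proof. by rewrite big_split. Qed.

Lemma Rsum_opp P F : \Rsum_(i : I | P i) (- F i) = - \Rsum_(i : I | P i) F i.
Proof. by rewrite (big_morph Ropp (id1 := R0) (op1 := Rplus)) //; [exact: Ropp_plus_distr | lra]. Qed.

Lemma Rsum_sub P F G : \Rsum_(i : I | P i) (F i - G i) =
  \Rsum_(i : I | P i) F i - \Rsum_(i : I | P i) G i.
Proof. by rewrite Rsum_add Rsum_opp. Qed.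

Lemma Rsum_const c P : \Rsum_(i : I | P i) c = INR #|P| * c.
Proof.
rewrite big_const; elim: #|P| => [|k IH] /=; first by rewrite Rmult_0_l.
rewrite IH -/(INR k.+1) S_INR; lra.
Qed.

Lemma Rsum_const_in c (W : {set I}) : \Rsum_(i : I | i \in W) c = INR #|W| * c.
Proof. by rewrite Rsum_const; congr (INR _ * c); apply: eq_card. Qed.

Lemma Rsum_constT c : \Rsum_(i : I) c = INR #|I| * c.
Proof. by rewrite Rsum_const. Qed.

Lemma Rabs_bigsum_le P F : Rabs (\Rsum_(i : I | P i) F i) <= \Rsum_(i : I | P i) Rabs (F i).
Proof.
apply: (big_ind2 (fun x y => Rabs x <= y)) => //; first by rewrite Rabs_R0; lra.
- by move=> x1 x2 y1 y2 h1 h2; have := Rabs_triang x1 y1; lra.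
- by move=> i _; lra.
Qed.

Lemma Rsum_term P F i : (forall i, P i -> 0 <= F i) -> P i ->
  F i <= \Rsum_(i : I | P i) F i.
Proof.
move=> h Pi; rewrite (bigD1 i) //=.
have : 0 <= \Rsum_(j : I | P j && (j != i)) F j; last lra.
by apply: Rsum_ge0 => j /andP[/h].
Qed.

Lemma Rsum_mkcond P F : \Rsum_(i : I | P i) F i = \Rsum_(i : I) (if P i then F i else 0).
Proof. exact: big_mkcond. Qed.

Lemma Rsum_le_mask P F : (forall i, 0 <= F i) ->
  \Rsum_(i : I | P i) F i <= \Rsum_(i : I) F i.
Proof.
by move=> h; rewrite Rsum_mkcond; apply: Rsum_le => i _; case: (P i) => //; lra.
Qed.

Lemma exp_Rsum P F : exp (\Rsum_(i : I | P i) F i) = \big[Rmult/R1]_(i : I | P i) exp (F i).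
Proof. by apply: (big_morph exp); [exact: exp_plus | exact: exp_0]. Qed.

Lemma Rprod_ge0 P F : (forall i, P i -> 0 <= F i) -> 0 <= \big[Rmult/R1]_(i : I | P i) F i.
Proof. by move=> h; apply: big_ind => //; [lra | exact: Rmult_le_pos]. Qed.

Lemma Rprod_le P F G : (forall i, P i -> 0 <= F i <= G i) ->
  \big[Rmult/R1]_(i : I | P i) F i <= \big[Rmult/R1]_(i : I | P i) G i.
Proof.
move=> h.
have : 0 <= \big[Rmult/R1]_(i : I | P i) F i <= \big[Rmult/R1]_(i : I | P i) G i; last by case.
apply: (big_ind2 (fun x y => 0 <= x <= y)) => //; first by lra.
move=> x1 x2 y1 y2 [h1 h2] [h3 h4]; split; first exact: Rmult_le_pos.
exact: Rmult_le_compat.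
Qed.

(** Cauchy-Schwarz against the constant 1: the sum of (F i - t)^2 is nonnegative for every t, and t
    is taken to be the mean. *)
Lemma Rsum_sqr_le P F : (\Rsum_(i : I | P i) F i) ^ 2 <=
  INR #|P| * \Rsum_(i : I | P i) F i ^ 2.
Proof.
set s := \Rsum_(i : I | P i) F i; set q := \Rsum_(i : I | P i) F i ^ 2.
have h t : 0 <= q - 2 * t * s + INR #|P| * t ^ 2.
  rewrite -Rsum_const /s /q -Rsum_mull -Rsum_sub -Rsum_add.
  by apply: Rsum_ge0 => i _; have := pow2_ge_0 (F i - t); lra.
have [n0 | n0] : INR #|P| = 0 \/ 0 < INR #|P| by have := pos_INR #|P|; lra.
  have P0 : #|P| = 0%N by apply: INR_eq; rewrite n0.
  by rewrite /s big_pred0 ?n0 => [|i]; [lra | move/card0_eq: P0 => /(_ i)].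
have := h (s / INR #|P|) => {}h.
have -> : s ^ 2 = INR #|P| * (2 * (s / INR #|P|) * s - INR #|P| * (s / INR #|P|) ^ 2).
  by field; lra.
apply: Rmult_le_compat_l; lra.
Qed.

End Sums.

(** * Exponential, sigmoid and softplus *)

Lemma Rabs_bounds x y : Rabs x <= y -> - y <= x <= y.
Proof. by move=> h; have := Rle_abs x; have := Rle_abs (- x); rewrite Rabs_Ropp; lra. Qed.

Lemma exp_monotone x y : x <= y -> exp x <= exp y.
Proof. by case=> [/exp_increasing|->]; lra. Qed.

Lemma exp_ge1D x : 1 + x <= exp x.
Proof. exact: exp_ineq1_le. Qed.

Lemma exp_lt1_lt0 x : exp x < 1 -> x < 0.
Proof. by move=> h; apply: exp_lt_inv; rewrite exp_0. Qed.

(** (1 + t + t^2) exp(-t) has derivative t (1 - t) exp(-t), so on t <= 1 its minimum is its value 1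
    at t = 0. *)
Lemma exp_le_quadratic x : x <= 1 -> exp x <= 1 + x + x ^ 2.
Proof.
move=> x1.
pose g t := (1 + t + t * t) * exp (- t).
pose g' t := (0 + 1 + (1 * t + t * 1)) * exp (- t)
             + (1 + t + t * t) * (exp (- t) * -1).
have dg t : derivable_pt_lim g t (g' t).
  rewrite /g /g'; apply: (derivable_pt_lim_mult (fun t => 1 + t + t * t) (fun t => exp (- t))).
    apply: (derivable_pt_lim_plus (fun t => 1 + t) (fun t => t * t)).
      apply: (derivable_pt_lim_plus (fun t => 1) (fun t => t)).
        exact: derivable_pt_lim_const.
      exact: derivable_pt_lim_id.
    apply: (derivable_pt_lim_mult (fun t => t) (fun t => t)); exact: derivable_pt_lim_id.
  apply: (derivable_pt_lim_comp (fun t => - t) exp); last exact: derivable_pt_lim_exp.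
  apply: (derivable_pt_lim_opp (fun t => t)); exact: derivable_pt_lim_id.
have g'E t : g' t = t * (1 - t) * exp (- t) by rewrite /g'; ring.
have g0 : g 0 = 1 by rewrite /g Ropp_0 exp_0; ring.
have gx : 1 <= g x.
  case: (Rtotal_order x 0) => [xn | [-> | xp]]; last 2 first; first by lra.
  - have [c [e [c0 c1]]] := MVT_cor2 g g' 0 x xp (fun t _ => dg t).
    have : 0 <= g' c * (x - 0); last by lra.
    rewrite g'E; apply: Rmult_le_pos; last lra.
    by apply: Rmult_le_pos; [apply: Rmult_le_pos; lra | have := exp_pos (- c); lra].
  - have [c [e [c0 c1]]] := MVT_cor2 g g' x 0 xn (fun t _ => dg t).
    have : 0 <= - g' c * (0 - x); last by lra.
    rewrite g'E; apply: Rmult_le_pos; last lra.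
    have -> : - (c * (1 - c) * exp (- c)) = - c * (1 - c) * exp (- c) by ring.
    by apply: Rmult_le_pos; [apply: Rmult_le_pos; lra | have := exp_pos (- c); lra].
have -> : 1 + x + x ^ 2 = exp x * g x.
  rewrite /g exp_Ropp; field; have := exp_pos x; lra.
by rewrite -{1}(Rmult_1_r (exp x)); apply: Rmult_le_compat_l => //; have := exp_pos x; lra.
Qed.

(** The point is the linear term x, which averages to zero for centred variables, and the validity
    for all real x. *)
Lemma exp_le_add_exp_sqr x : exp x <= x + exp (x ^ 2).
Proof.
have h := exp_ge1D (x ^ 2).
case: (Rle_lt_dec x 1) => hx; first by have := exp_le_quadratic hx; lra.
have : exp x <= exp (x ^ 2) by apply: exp_monotone; nra.
by nra.
Qed.

(** A centred Bernoulli variable is sub-Gaussian: the linear terms of [exp_le_add_exp_sqr] cancel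
    and both squares are at most t^2. The constant is cruder than Hoeffding's. *)
Lemma bernoulli_mgf q t : 0 <= q <= 1 ->
  q * exp (t * (1 - q)) + (1 - q) * exp (t * (0 - q)) <= exp (t ^ 2).
Proof.
move=> hq.
have h c : 0 <= c ^ 2 <= 1 -> exp (t * c) <= t * c + exp (t ^ 2).
  move=> hc; have := exp_le_add_exp_sqr (t * c).
  have : exp ((t * c) ^ 2) <= exp (t ^ 2); last by lra.
  by apply: exp_monotone; have := pow2_ge_0 t; nra.
have h1 := h (1 - q); have h2 := h (0 - q).
have {}h1 := h1 ltac:(nra); have {}h2 := h2 ltac:(nra).
have := Rmult_le_compat_l q _ _ (proj1 hq) h1.
have := Rmult_le_compat_l (1 - q) _ _ ltac:(lra) h2.
nra.
Qed.

Definition sigmoid (x : R) : R := exp x / (1 + exp x).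

Lemma sigmoid_bounds x : 0 <= sigmoid x <= 1.
Proof.
have h := exp_pos x; split; first by apply: Rlt_le; apply: Rdiv_lt_0_compat; lra.
by apply: (Rmult_le_reg_r (1 + exp x)); [lra | rewrite /sigmoid /Rdiv Rmult_assoc Rinv_l; lra].
Qed.

Lemma sigmoidB x y : sigmoid x - sigmoid y =
  exp y * (exp (x - y) - 1) / ((1 + exp x) * (1 + exp y)).
Proof.
have hx := exp_pos x; have hy := exp_pos y.
have -> : exp (x - y) = exp x / exp y by rewrite exp_plus exp_Ropp.
by rewrite /sigmoid; field; split; [lra | split; lra].
Qed.

Lemma sigmoidN x : sigmoid (- x) = 1 - sigmoid x.
Proof. by have h := exp_pos x; rewrite /sigmoid exp_Ropp; field; lra. Qed.

Lemma sigmoid_le x y : x <= y -> sigmoid x <= sigmoid y.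
Proof.
move=> h; have hx := exp_pos x; have hy := exp_pos y; have hd := exp_ge1D (y - x).
suff : 0 <= sigmoid y - sigmoid x by lra.
rewrite sigmoidB; apply: Rmult_le_pos; first by apply: Rmult_le_pos; lra.
by apply: Rlt_le; apply: Rinv_0_lt_compat; apply: Rmult_lt_0_compat; lra.
Qed.

Lemma sigmoid_lip x y : Rabs (sigmoid x - sigmoid y) <= Rabs (x - y).
Proof.
wlog h : x y / x <= y => [th|].
  case: (Rle_dec x y) => h; first exact: th.
  by rewrite Rabs_minus_sym (Rabs_minus_sym x); apply: th; lra.
have := sigmoid_le h => hs; rewrite !Rabs_left1; try lra.
have hx := exp_pos x; have hy := exp_pos y; have hd := exp_ge1D (x - y).
have -> : - (sigmoid x - sigmoid y) = exp y * (1 - exp (x - y)) / ((1 + exp x) * (1 + exp y)).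
  by rewrite sigmoidB; field; lra.
have hd1 : exp (x - y) <= 1 by rewrite -exp_0; apply: exp_monotone; lra.
apply: (Rmult_le_reg_r ((1 + exp x) * (1 + exp y))); first by apply: Rmult_lt_0_compat; lra.
rewrite /Rdiv Rmult_assoc Rinv_l; last by apply: Rgt_not_eq; apply: Rmult_lt_0_compat; lra.
have h1 : exp y * (1 - exp (x - y)) <= exp y * (y - x) by apply: Rmult_le_compat_l; lra.
have h2 : exp y * (y - x) <= (1 + exp x) * (1 + exp y) * (y - x).
  by apply: Rmult_le_compat_r; nra.
lra.
Qed.

(** A crude lower bound for the derivative exp x / (1 + exp x)^2 of the sigmoid on [-M, M]. *)
Definition sig_slope (M : R) : R := exp (- M) / (1 + exp M) ^ 2.

Lemma sig_slope_gt0 M : 0 < sig_slope M.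
Proof.
by have h := exp_pos M; apply: Rdiv_lt_0_compat; [exact: exp_pos | apply: pow_lt; lra].
Qed.

Lemma sig_slope_le1 M : 0 <= M -> sig_slope M <= 1.
Proof.
move=> M0; have h := exp_pos M.
have h' : exp (- M) <= 1 by rewrite -exp_0; apply: exp_monotone; lra.
apply: (Rmult_le_reg_r ((1 + exp M) ^ 2)); first by apply: pow_lt; lra.
rewrite /sig_slope /Rdiv Rmult_assoc Rinv_l; last by apply: Rgt_not_eq; apply: pow_lt; lra.
nra.
Qed.

Lemma sigmoid_slope M x y : Rabs x <= M -> Rabs y <= M -> 
  sig_slope M * (x - y) ^ 2 <= (sigmoid x - sigmoid y) * (x - y).
Proof.
move=> hx hy; wlog h : x y hx hy / x <= y => [th|].
  case: (Rle_dec x y) => h; first exact: th.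
  by have := th y x hy hx ltac:(lra); lra.
have {}hx := Rabs_bounds hx; have {}hy := Rabs_bounds hy.
suff hs : sig_slope M * (y - x) <= sigmoid y - sigmoid x by nra.
have px := exp_pos x; have py := exp_pos y; have pM := exp_pos M; have hd := exp_ge1D (y - x).
rewrite sigmoidB /sig_slope.
have h1 : exp (- M) * (y - x) <= exp x * (exp (y - x) - 1).
  apply: Rmult_le_compat; [exact/Rlt_le/exp_pos | lra | | lra].
  by apply: exp_monotone; lra.
have h2 : (1 + exp y) * (1 + exp x) <= (1 + exp M) ^ 2.
  rewrite /= Rmult_1_r; apply: Rmult_le_compat; try lra.
  - by have : exp y <= exp M by [apply: exp_monotone; lra]; lra.
  - by have : exp x <= exp M by [apply: exp_monotone; lra]; lra.
have h3 : 0 < (1 + exp y) * (1 + exp x) by apply: Rmult_lt_0_compat; lra.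
have -> : exp (- M) / (1 + exp M) ^ 2 * (y - x) = exp (- M) * (y - x) * / (1 + exp M) ^ 2.
  by field; lra.
apply: Rmult_le_compat => //.
- by apply: Rmult_le_pos; [exact/Rlt_le/exp_pos | lra].
- by apply/Rlt_le/Rinv_0_lt_compat; lra.
- exact: Rinv_le_contravar.
Qed.

Lemma ln_monotone x y : 0 < x -> x <= y -> ln x <= ln y.
Proof. by move=> x0 [/(ln_increasing _ _ x0)|->]; lra. Qed.

Definition softplus (u : R) : R := ln (1 + exp u).

Lemma softplus_ge0 u : 0 <= softplus u.
Proof. by rewrite /softplus -ln_1; apply: ln_monotone; have := exp_pos u; lra. Qed.

Lemma softplus_gt u : u <= softplus u.
Proof. by rewrite /softplus -[X in X <= _]ln_exp; apply: ln_monotone; have := exp_pos u; lra. Qed.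

(* With q = sigmoid u, [softplus (u + t) - softplus u - t q] is the logarithm of the moment
   generating function of a centred Bernoulli(q) variable. *)
Lemma softplus_smooth u t : softplus (u + t) <= softplus u + t * sigmoid u + t ^ 2.
Proof.
have hu := exp_pos u; have ht := exp_pos t; have hut := exp_pos (u + t).
have hq := sigmoid_bounds u.
have := bernoulli_mgf t hq.
have -> : t * (1 - sigmoid u) = t + - (t * sigmoid u) by ring.
have -> : t * (0 - sigmoid u) = - (t * sigmoid u) by ring.
rewrite exp_plus => h.
have e : 1 + exp (u + t) = (1 + exp u) * (sigmoid u * exp t + (1 - sigmoid u)).
  by rewrite exp_plus /sigmoid; field; lra.
have h' : sigmoid u * exp t + (1 - sigmoid u) <= exp (t ^ 2 + t * sigmoid u).
  rewrite exp_plus; have hE := exp_pos (t * sigmoid u).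
  have hinv : exp (- (t * sigmoid u)) * exp (t * sigmoid u) = 1.
    by rewrite -exp_plus Rplus_opp_l exp_0.
  have := Rmult_le_compat_r _ _ _ (Rlt_le _ _ hE) h.
  set E := exp (t * sigmoid u) in hinv *; set E' := exp (- _) in hinv *.
  have -> : (sigmoid u * (exp t * E') + (1 - sigmoid u) * E') * E =
    (sigmoid u * exp t + (1 - sigmoid u)) * (E' * E) by ring.
  by rewrite hinv; lra.
have pos : 0 < sigmoid u * exp t + (1 - sigmoid u).
  apply: (Rmult_lt_reg_l (1 + exp u)); lra.
rewrite /softplus e ln_mult //; last lra.
have := ln_monotone pos h'; rewrite ln_exp; lra.
Qed.

(** * The product measure on outcomes *)

Section Experiment.
Variables (n L : nat) (w : 'I_n -> R) (p : R).
Hypotheses (w_gt0 : forall i, 0 < w i) (p01 : 0 <= p <= 1).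
Notation outc := (outcome n L).
Notation comparisons := {ffun 'I_L -> bool}.
Implicit Types (i j : 'I_n) (o : outc).

Definition Ex (f : outc -> R) : R := \Rsum_(o : outc) (weight w p o * f o).

Definition loser_prob (i j : 'I_n) : R := w j / (w i + w j).

Definition pair_weight (i j : 'I_n) (a : bool) (y : comparisons) : R :=
  if (j < i)%N then bern p a * \Rprod_(l : 'I_L) bern (loser_prob i j) (y l)
  else (if a then 0 else 1) * \Rprod_(l : 'I_L) (if y l then 0 else 1).

Definition pair_mean (i j : 'I_n) (f : bool -> comparisons -> R) : R :=
  \Rsum_(a : bool) \Rsum_(y : comparisons) (pair_weight i j a y * f a y).

Definition comparison_mean (q : R) (f : comparisons -> R) : R :=
  \Rsum_(y : comparisons) ((\Rprod_(l : 'I_L) bern q (y l)) * f y).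

Lemma loser_prob01 i j : 0 <= loser_prob i j <= 1.
Proof.
have hi := w_gt0 i; have hj := w_gt0 j; rewrite /loser_prob; split.
  by apply: Rlt_le; apply: Rdiv_lt_0_compat; lra.
by apply: (Rmult_le_reg_r (w i + w j)); [lra | rewrite /Rdiv Rmult_assoc Rinv_l; lra].
Qed.

Lemma bern_ge0 q b : 0 <= q <= 1 -> 0 <= bern q b.
Proof. by case: b => /=; lra. Qed.

Lemma pair_weight_ge0 i j a y : 0 <= pair_weight i j a y.
Proof.
rewrite /pair_weight; case: ifP => _; apply: Rmult_le_pos.
- exact: bern_ge0.
- by apply: Rprod_ge0 => l _; apply: bern_ge0; exact: loser_prob01.
- by case: a; lra.
- by apply: Rprod_ge0 => l _; case: (y l); lra.
Qed.

Lemma weightE (o : outc) : weight w p o =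
  \Rprod_(i : 'I_n) \Rprod_(j : 'I_n) pair_weight i j (o.1 i j) (o.2 i j).
Proof. by []. Qed.

Lemma weight_ge0 (o : outc) : 0 <= weight w p o.
Proof. by rewrite weightE; do 2![apply: Rprod_ge0 => ? _]; exact: pair_weight_ge0. Qed.

Lemma prod_sum_ffun (X : finType) (G : 'I_n -> 'I_n -> X -> R) :
  \Rprod_(i : 'I_n) \Rprod_(j : 'I_n) (\Rsum_(x : X) G i j x) =
  \Rsum_(f : {ffun 'I_n -> {ffun 'I_n -> X}}) \Rprod_(i : 'I_n) \Rprod_(j : 'I_n) G i j (f i j).
Proof.
under eq_bigr => i _ do rewrite bigA_distr_bigA.
by rewrite bigA_distr_bigA.
Qed.

Lemma Ex_prod (f : 'I_n -> 'I_n -> bool -> comparisons -> R) :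
  Ex (fun o => \Rprod_(i : 'I_n) \Rprod_(j : 'I_n) f i j (o.1 i j) (o.2 i j)) =
  \Rprod_(i : 'I_n) \Rprod_(j : 'I_n) pair_mean i j (f i j).
Proof.
rewrite /pair_mean prod_sum_ffun.
under [RHS]eq_bigr => a _ do rewrite prod_sum_ffun.
rewrite pair_big /=; apply: eq_bigr => -[a y] _ /=.
rewrite weightE -big_split /=; apply: eq_bigr => i _.
by rewrite -big_split /=; apply: eq_bigr => j _.
Qed.

Lemma comparison_mean1 q : comparison_mean q (fun=> 1) = 1.
Proof.
rewrite /comparison_mean; under eq_bigr => y _ do rewrite Rmult_1_r.
rewrite -(bigA_distr_bigA (fun _ b => bern q b)) big1 // => l _.
by rewrite big_bool /=; lra.
Qed.

Lemma pair_mean_lt i j f : (j < i)%N -> pair_mean i j f =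
  p * comparison_mean (loser_prob i j) (f true) +
  (1 - p) * comparison_mean (loser_prob i j) (f false).
Proof.
move=> ji; rewrite /pair_mean big_bool /= /pair_weight ji /= -!Rsum_mull.
by congr (_ + _); apply: eq_bigr => y _; rewrite Rmult_assoc.
Qed.

Lemma pair_mean1 i j : pair_mean i j (fun _ _ => 1) = 1.
Proof.
have [ji | ij] := boolP (j < i)%N.
  by rewrite pair_mean_lt // comparison_mean1; lra.
rewrite /pair_mean big_bool /= /pair_weight (negPf ij) big1 => [|y _]; last lra.
rewrite Rplus_0_l.
under eq_bigr => y _ do rewrite Rmult_1_r Rmult_1_l.
rewrite -(bigA_distr_bigA (fun _ (b : bool) => if b then 0 else 1)) big1 // => l _.
by rewrite big_bool /=; lra.
Qed.

Lemma Ex1 : Ex (fun=> 1) = 1.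
Proof.
have := Ex_prod (fun _ _ _ _ => 1).
rewrite [X in _ = X]big1 => [h | i _]; last by rewrite big1 // => j _; rewrite pair_mean1.
by apply: etrans h; apply: eq_bigr => o _; rewrite big1 // => i _; rewrite big1.
Qed.

Lemma Ex_le f g : (forall o, f o <= g o) -> Ex f <= Ex g.
Proof.
move=> h; apply: Rsum_le => o _.
by apply: Rmult_le_compat_l; [exact: weight_ge0 | exact: h].
Qed.

Lemma Ex_const c : Ex (fun=> c) = c.
Proof.
rewrite -{2}(Rmult_1_l c) -Ex1 /Ex -Rsum_mulr; apply: eq_bigr => o _; lra.
Qed.

Lemma Ex_mulr f c : Ex (fun o => f o * c) = Ex f * c.
Proof. by rewrite /Ex -Rsum_mulr; apply: eq_bigr => o _; rewrite Rmult_assoc. Qed.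

Lemma Ex_add f g : Ex (fun o => f o + g o) = Ex f + Ex g.
Proof. by rewrite /Ex -Rsum_add; apply: eq_bigr => o _; lra. Qed.

Lemma Ex_sum (I : finType) (P : pred I) (f : I -> outc -> R) :
  Ex (fun o => \Rsum_(i : I | P i) f i o) = \Rsum_(i : I | P i) Ex (f i).
Proof.
rewrite /Ex; under eq_bigr => o _ do rewrite -Rsum_mull.
by rewrite exchange_big.
Qed.

Lemma prob_ge (E : outc -> Prop) (Z : outc -> R) b :
  (forall o, 0 <= Z o) -> (forall o, Z o < 1 -> E o) -> Ex Z <= b -> prob w p E >= 1 - b.
Proof.
move=> Z0 ZE Zb; have h : 1 - Ex Z <= prob w p E; last lra.
rewrite -Ex1 /Ex -Rsum_sub; apply: Rsum_le => o _; have := weight_ge0 o => W0.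
case: (excluded_middle_informative (E o)) => [Eo | nE] /=.
  by have := Rmult_le_pos _ _ W0 (Z0 o); lra.
have : 1 <= Z o by apply: Rnot_lt_le => /ZE.
by move/(Rmult_le_compat_l _ _ _ W0); lra.
Qed.

(** * Symmetrised edges and exponential moments over pairs *)

Definition adj (o : outc) (i j : 'I_n) : bool :=
  if (j < i)%N then o.1 i j else if (i < j)%N then o.1 j i else false.

(** [ybar o i j] counts the comparisons won by j, hence the complement when j < i. On the diagonal
    the value is meaningless, but there [adj] is false. *)
Definition win_freq (o : outc) (i j : 'I_n) : R :=
  if (j < i)%N then 1 - ybar o i j else ybar o j i.

Definition win_prob (i j : 'I_n) : R := w i / (w i + w j).

Lemma adj_sym o i j : adj o i j = adj o j i.
Proof. by rewrite /adj; case: ltngtP. Qed.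

Lemma adj_irr o i : adj o i i = false.
Proof. by rewrite /adj ltnn. Qed.

Lemma win_freqC o i j : i != j -> win_freq o j i = 1 - win_freq o i j.
Proof.
by rewrite -val_eqE /win_freq /=; case: ltngtP => //= _ _; lra.
Qed.

Lemma win_probC i j : win_prob j i = 1 - win_prob i j.
Proof. by have := w_gt0 i; have := w_gt0 j; rewrite /win_prob => hi hj; field; lra. Qed.

(** The two orientations of a pair carry the same randomness, so they are merged before independence
    is used. *)
Lemma double_sum_lower (G : 'I_n -> 'I_n -> R) : (forall i, G i i = 0) ->
  \Rsum_(i : 'I_n) \Rsum_(j : 'I_n) G i j =
  \Rsum_(i : 'I_n) \Rsum_(j : 'I_n | (j < i)%N) (G i j + G j i).
Proof.
move=> G0.
have -> : \Rsum_(i : 'I_n) \Rsum_(j : 'I_n) G i j =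
   \Rsum_(i : 'I_n) \Rsum_(j : 'I_n | (j < i)%N) G i j +
   \Rsum_(i : 'I_n) \Rsum_(j : 'I_n | (i < j)%N) G i j.
  rewrite -Rsum_add; apply: eq_bigr => i _.
  rewrite (bigID (fun j : 'I_n => (j < i)%N)) /=; congr (_ + _).
  rewrite (bigD1 i) ?ltnn //= G0 Rplus_0_l; apply: eq_bigl => j.
  by rewrite -leqNgt -val_eqE /=; case: ltngtP.
under [RHS]eq_bigr => i _ do rewrite Rsum_add.
rewrite Rsum_add; congr (_ + _).
under eq_bigr => i _ do rewrite Rsum_mkcond.
rewrite exchange_big; apply: eq_bigr => i _ /=.
by rewrite -Rsum_mkcond.
Qed.

Lemma Ex_exp_le (X : 'I_n -> 'I_n -> bool -> comparisons -> R) (v : 'I_n -> 'I_n -> R) :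
  (forall i j : 'I_n, (j < i)%N -> pair_mean i j (fun a y => exp (X i j a y)) <= exp (v i j)) ->
  Ex (fun o => exp (\Rsum_(i : 'I_n) \Rsum_(j : 'I_n | (j < i)%N) X i j (o.1 i j) (o.2 i j)))
  <= exp (\Rsum_(i : 'I_n) \Rsum_(j : 'I_n | (j < i)%N) v i j).
Proof.
move=> h; pose f i j a y := if (j < i)%N then exp (X i j a y) else 1.
have -> : Ex (fun o => exp (\Rsum_(i : 'I_n) \Rsum_(j : 'I_n | (j < i)%N) X i j (o.1 i j) (o.2 i j)))
  = Ex (fun o => \Rprod_(i : 'I_n) \Rprod_(j : 'I_n)
      f i j (o.1 i j) (o.2 i j)).
  apply: eq_bigr => o _; congr (_ * _); rewrite exp_Rsum; apply: eq_bigr => i _.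
  by rewrite exp_Rsum big_mkcond.
rewrite (Ex_prod f) exp_Rsum; apply: Rprod_le => i _.
rewrite exp_Rsum [X in _ <= _ <= X]big_mkcond.
have H j : 0 <= pair_mean i j (f i j) <=
   (if (j < i)%N then exp (v i j) else 1).
  split.
    do 2![apply: Rsum_ge0 => ? _]; apply: Rmult_le_pos; first exact: pair_weight_ge0.
    by rewrite /f; case: ifP => _; [exact/Rlt_le/exp_pos | lra].
  by rewrite /f; case: ifP => [/h // | _]; rewrite pair_mean1; lra.
by split; [apply: Rprod_ge0 => j _; case: (H j) | apply: Rprod_le].
Qed.

(** Only [v i j + v j i] matters: the cost of a pair may be charged to either orientation, which
    lets callers put it in a single row or block. *)
Lemma Ex_exp_adj_le (c v : 'I_n -> 'I_n -> R) : (forall i, v i i = 0) ->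
  (forall i j : 'I_n, i != j -> 1 - p + p * exp (c i j + c j i) <= exp (v i j + v j i)) ->
  Ex (fun o => exp (\Rsum_(i : 'I_n) \Rsum_(j : 'I_n) (if adj o i j then c i j else 0)))
  <= exp (\Rsum_(i : 'I_n) \Rsum_(j : 'I_n) v i j).
Proof.
move=> v0 h; rewrite double_sum_lower //.
have := @Ex_exp_le (fun i j a _ => if a then c i j + c j i else 0) (fun i j => v i j + v j i).
move=> H; apply: Rle_trans (H _) => [|i j ji]; last first.
  rewrite pair_mean_lt //=; have := h i j.
  have -> : i != j by rewrite -val_eqE gtn_eqF.
  move=> /(_ isT) {}h.
  have E c' : comparison_mean (loser_prob i j) (fun=> c') = c'.
    rewrite /comparison_mean Rsum_mulr -[RHS]Rmult_1_l -[in RHS](comparison_mean1 (loser_prob i j)).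
    by congr (_ * _); apply: eq_bigr => y _; rewrite Rmult_1_r.
  by rewrite !E exp_0; lra.
apply: Req_le; apply: eq_bigr => o _; congr (_ * exp _).
rewrite double_sum_lower => [|i]; last by rewrite adj_irr.
apply: eq_bigr => i _; apply: eq_bigr => j ji.
by rewrite (adj_sym o j i) /adj ji; case: ifP => _; lra.
Qed.

(** Each of the L independent comparisons enters with weight t / L and contributes (t / L)^2. *)
Lemma comparison_mgf q t : (0 < L)%N -> 0 <= q <= 1 ->
  comparison_mean q (fun y => exp (t * ((\Rsum_(l : 'I_L) (if y l then 1 else 0)) / INR L - q)))
  <= exp (t ^ 2 / INR L).
Proof.
move=> /ltP/lt_0_INR L0 q01.
pose F (l : 'I_L) (b : bool) := bern q b * exp (t / INR L * ((if b then 1 else 0) - q)).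
have e (y : comparisons) :
    (\Rprod_(l : 'I_L) bern q (y l)) *
      exp (t * ((\Rsum_(l : 'I_L) (if y l then 1 else 0)) / INR L - q)) =
    \Rprod_(l : 'I_L) F l (y l).
  rewrite big_split /= -exp_Rsum; congr (_ * exp _).
  rewrite Rsum_mull Rsum_sub Rsum_constT card_ord.
  by set S := (X in X / INR L); rewrite -/S; field; lra.
rewrite /comparison_mean; under eq_bigr => y _ do rewrite e.
rewrite -(bigA_distr_bigA F).
have -> : t ^ 2 / INR L = \Rsum_(l : 'I_L) (t / INR L) ^ 2.
  by rewrite Rsum_constT card_ord; field; lra.
rewrite exp_Rsum; apply: Rprod_le => l _; rewrite big_bool /F /=; split.
  have := exp_pos (t / INR L * (1 - q)); have := exp_pos (t / INR L * (0 - q)).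
  by move=> h1 h2; apply: Rplus_le_le_0_compat; apply: Rmult_le_pos; lra.
exact: bernoulli_mgf.
Qed.

(** The centred win frequency is antisymmetric in its pair, so a pair has total coefficient
    [c i j - c j i]. *)
Lemma Ex_exp_noise_le (c v : 'I_n -> 'I_n -> R) : (0 < L)%N -> (forall i, v i i = 0) ->
  (forall i j, i != j -> 1 - p + p * exp ((c i j - c j i) ^ 2 / INR L) <= exp (v i j + v j i)) ->
  Ex (fun o => exp (\Rsum_(i : 'I_n) \Rsum_(j : 'I_n)
    (if adj o i j then c i j * (win_freq o i j - win_prob i j) else 0)))
  <= exp (\Rsum_(i : 'I_n) \Rsum_(j : 'I_n) v i j).
Proof.
move=> L0 v0 h; rewrite double_sum_lower //.
pose X i j (a : bool) (y : comparisons) := if a then (c j i - c i j) *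
  ((\Rsum_(l : 'I_L) (if y l then 1 else 0)) / INR L - loser_prob i j) else 0.
apply: Rle_trans (@Ex_exp_le X (fun i j => v i j + v j i) _) => [|i j ji]; last first.
  have ij : i != j by rewrite -val_eqE gtn_eqF.
  rewrite pair_mean_lt // /X exp_0 comparison_mean1; have := h i j ij.
  have := comparison_mgf (c j i - c i j) L0 (loser_prob01 i j).
  have -> : (c j i - c i j) ^ 2 = (c i j - c j i) ^ 2 by ring.
  by move/(Rmult_le_compat_l _ _ _ (proj1 p01)); lra.
apply: Req_le; apply: eq_bigr => o _; congr (_ * exp _).
rewrite double_sum_lower => [|i]; last by rewrite adj_irr.
apply: eq_bigr => i _; apply: eq_bigr => j ji.
have ij : i != j by rewrite -val_eqE gtn_eqF.
rewrite (win_freqC _ ij) (win_probC i j) (adj_sym o j i) {1 2}/adj ji /X.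
case: ifP => _; last lra.
have -> : win_freq o i j = 1 - ybar o i j by rewrite /win_freq ji.
have -> : win_prob i j = 1 - loser_prob i j.
  by have := w_gt0 i; have := w_gt0 j; rewrite /win_prob /loser_prob => hi hj; field; lra.
by rewrite /ybar; set S := (X in X / INR L); rewrite -/S; ring.
Qed.

(** * Resampling the coordinates of one item *)

Definition resample (m : 'I_n) (o o' : outc) : outc :=
  ([ffun i => [ffun j => if (i == m) || (j == m) then o'.1 i j else o.1 i j]],
   [ffun i => [ffun j => if (i == m) || (j == m) then o'.2 i j else o.2 i j]]).

Lemma resampleK m o o' : resample m (resample m o o') (resample m o' o) = o.
Proof.
case: o => a y; rewrite /resample /=; congr (_, _); apply/ffunP => i; rewrite !ffunE;
  by apply/ffunP => j; rewrite !ffunE; case: ifP => ->.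
Qed.

Lemma weight_resample m o o' : weight w p o * weight w p o' =
  weight w p (resample m o o') * weight w p (resample m o' o).
Proof.
rewrite !weightE -!big_split; apply: eq_bigr => i _ /=.
rewrite -!big_split; apply: eq_bigr => j _ /=; rewrite !ffunE.
by case: ifP => _; rewrite // Rmult_comm.
Qed.

(* Exchanging the coordinates of item m between two independent copies is a weight-preserving
   involution. *)
Lemma Ex_resample m (f : outc -> R) : Ex f = Ex (fun o => Ex (fun o' => f (resample m o o'))).
Proof.
rewrite {2 3}/Ex; under eq_bigr => o _ do rewrite -Rsum_mull.
rewrite pair_big /=.
pose h (u : outc * outc) := (resample m u.1 u.2, resample m u.2 u.1).
have hK : involutive h by case=> o o'; rewrite /h /= !resampleK.
rewrite (reindex_inj (inv_inj hK)) /=.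
rewrite -[LHS]Rmult_1_r -Ex1 /Ex -Rsum_mulr.
under eq_bigr => o _ do rewrite -Rsum_mull.
rewrite pair_big /=; apply: eq_bigr => -[o o'] _ /=.
by rewrite resampleK -[RHS]Rmult_assoc -weight_resample; lra.
Qed.

Lemma adj_resample m o o' j : adj (resample m o o') m j = adj o' m j.
Proof. by rewrite /adj /= !ffunE !eqxx orbT. Qed.

(* After resampling the coordinates of m, u is a constant for the inner expectation. *)
Lemma Ex_exp_star m (u : outc -> 'I_n -> R) :
  (forall o o', u (resample m o o') = u o) -> (forall o j, 0 <= u o j <= 1) ->
  Ex (fun o => exp (\Rsum_(j : 'I_n) (if adj o m j then u o j else 0)
                    - 2 * p * \Rsum_(j : 'I_n) u o j)) <= 1.
Proof.
move=> um u01; rewrite (Ex_resample m) -[X in _ <= X](Ex_const 1); apply: Ex_le => o.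
set V := \Rsum_(j : 'I_n) u o j.
have -> : Ex (fun o' => exp (\Rsum_(j : 'I_n) (if adj (resample m o o') m j
        then u (resample m o o') j else 0) - 2 * p * \Rsum_(j : 'I_n) u (resample m o o') j))
   = Ex (fun o' => exp (\Rsum_(i : 'I_n) \Rsum_(j : 'I_n)
        (if adj o' i j then (if i == m then u o j else 0) else 0))) * exp (- (2 * p * V)).
  rewrite -Ex_mulr; apply: eq_bigr => o' _; rewrite -exp_plus; congr (_ * exp _).
  rewrite um -/V; congr (_ + _); rewrite [RHS](bigD1 m) //= [X in _ = _ + X]big1 => [|i im].
    rewrite [RHS]Rplus_0_r; by apply: eq_bigr => j _; rewrite adj_resample eqxx.
  by apply: big1 => j _; rewrite (negPf im); case: ifP.
(* The factor 2 comes from exp u <= 1 + u + u^2 <= 1 + 2 u for u in [0, 1]. *)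
pose v i j := if (i == m) && (j != m) then 2 * p * u o j else 0.
have vi i : v i i = 0 by rewrite /v; case: eqP.
have hv i j : i != j -> 1 - p + p * exp ((if i == m then u o j else 0) +
    (if j == m then u o i else 0)) <= exp (v i j + v j i).
  rewrite /v; have [-> | im] := eqVneq i m; have [-> | jm] := eqVneq j m;
    rewrite ?eqxx //= ?Rplus_0_r ?Rplus_0_l ?exp_0; try lra.
  - move=> _; have hu := u01 o j; have := @exp_le_quadratic (u o j) ltac:(lra).
    have := exp_ge1D (2 * p * u o j).
    have h2 : p * (u o j) ^ 2 <= p * u o j by apply: Rmult_le_compat_l; [lra | nra].
    by move=> h /(Rmult_le_compat_l _ _ _ (proj1 p01)); lra.
  - move=> _; have hu := u01 o i; have := @exp_le_quadratic (u o i) ltac:(lra).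
    have := exp_ge1D (2 * p * u o i).
    have h2 : p * (u o i) ^ 2 <= p * u o i by apply: Rmult_le_compat_l; [lra | nra].
    by move=> h /(Rmult_le_compat_l _ _ _ (proj1 p01)); lra.
have := Ex_exp_adj_le vi hv.
have hV : \Rsum_(i : 'I_n) \Rsum_(j : 'I_n) v i j <= 2 * p * V.
  rewrite (bigD1 m) //= [X in _ + X]big1 => [|i im].
    rewrite Rplus_0_r -Rsum_mull; apply: Rsum_le => j _; rewrite /v eqxx /=.
    case: ifP => _; [lra | apply: Rmult_le_pos; [lra | by case: (u01 o j)]].
  by apply: big1 => j _; rewrite /v (negPf im).
move/(fun h => Rle_trans _ _ _ h (exp_monotone hV)).
have hp := exp_pos (- (2 * p * V)).
move/(Rmult_le_compat_r _ _ _ (Rlt_le _ _ hp)).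
by rewrite -exp_plus Rplus_opp_r exp_0.
Qed.

End Experiment.

(** * Poincare inequality and logistic stability on a graph *)

Lemma seq_argmin (I : eqType) (F : I -> R) (x : I) (s : seq I) :
  exists2 i, i \in x :: s & forall j, j \in x :: s -> F i <= F j.
Proof.
elim: s x => [|y s IH] x.
  by exists x => [|j]; rewrite ?mem_head // inE => /eqP ->; lra.
have [i ii hi] := IH y; case: (Rle_lt_dec (F i) (F x)) => h.
  exists i => [|j]; rewrite inE ?ii ?orbT // => /orP[/eqP -> //|]; exact: hi.
exists x => [|j]; rewrite ?mem_head // inE => /orP[/eqP ->|/hi]; lra.
Qed.

Lemma set_argmin (I : finType) (F : I -> R) (S : {set I}) : S != set0 ->
  exists2 i, i \in S & forall j, j \in S -> F i <= F j.
Proof.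
move=> /set0Pn[x xS].
have := mem_enum S; case: (enum S) => [/(_ x)|y s e]; first by rewrite xS.
by have [i ii hi] := seq_argmin F y s; exists i => [|j jS]; [rewrite -e | apply: hi; rewrite e].
Qed.

Lemma fin_argmax (I : finType) (F : I -> R) (x : I) : exists i, forall j, F j <= F i.
Proof.
have h : [set: I] != set0 by apply/set0Pn; exists x.
have [i _ hi] := set_argmin (fun i => - F i) h.
by exists i => j; have := hi j (in_setT j); lra.
Qed.

Section Graph.
Variable V : finType.
Implicit Types (i j : V) (S W : {set V}) (u v x z t : V -> R) (A : rel V).

Definition indic S i : R := if i \in S then 1 else 0.

(* |u i - u j| is a nonnegative combination of the cuts of the superlevel sets of u. *)
Lemma cut_ineq_l1 (c : V -> V -> R) :
  (forall S, 0 <= \Rsum_(i : V) \Rsum_(j : V) (c i j * Rabs (indic S i - indic S j))) ->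
  forall u, 0 <= \Rsum_(i : V) \Rsum_(j : V) (c i j * Rabs (u i - u j)).
Proof.
move=> hc u0.
have main k : forall S u b, (#|S| <= k)%N -> (forall i, i \notin S -> u i = b) ->
    (forall i, i \in S -> b <= u i) ->
    0 <= \Rsum_(i : V) \Rsum_(j : V) (c i j * Rabs (u i - u j)).
  elim: k => [|k IH] S u b Sk out ins.
    have S0 : S = set0 by apply/eqP; rewrite -cards_eq0 -leqn0.
    apply: Req_le; symmetry; rewrite big1 // => i _; rewrite big1 // => j _.
    by rewrite !out ?S0 ?inE // Rminus_diag Rabs_R0; lra.
  have [S0 | S0] := eqVneq S set0; first by apply: (IH S u b); rewrite // S0 cards0.
  have [i0 i0S hi0] := set_argmin u S0.
  (* Lowering u on S by its least excess d brings i0 down to b and splits off d times the cut of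
     S. *)
  pose d := u i0 - b; pose u' i := u i - d * indic S i.
  have d0 : 0 <= d by rewrite /d; have := ins _ i0S; lra.
  have dec i j : Rabs (u i - u j) = Rabs (u' i - u' j) + d * Rabs (indic S i - indic S j).
    rewrite /u' /indic; case: ifP => iS; case: ifP => jS.
    - by rewrite Rminus_diag Rabs_R0 Rmult_0_r Rplus_0_r; congr Rabs; ring.
    - have := hi0 i iS; rewrite (out j) ?jS // => h; rewrite /d in d0 *.
      by rewrite !Rabs_right; lra.
    - have := hi0 j jS; rewrite (out i) ?iS // => h; rewrite /d in d0 *.
      by rewrite !Rabs_left1; lra.
    - by rewrite Rminus_diag Rabs_R0 Rmult_0_r Rplus_0_r; congr Rabs; ring.
  have -> : \Rsum_(i : V) \Rsum_(j : V) (c i j * Rabs (u i - u j)) =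
     \Rsum_(i : V) \Rsum_(j : V) (c i j * Rabs (u' i - u' j)) +
     d * \Rsum_(i : V) \Rsum_(j : V) (c i j * Rabs (indic S i - indic S j)).
    rewrite -Rsum_mull -Rsum_add; apply: eq_bigr => i _.
    rewrite -Rsum_mull -Rsum_add; apply: eq_bigr => j _; rewrite dec; ring.
  apply: Rplus_le_le_0_compat; last exact: Rmult_le_pos.
  apply: (IH (S :\ i0) u' b).
  - by rewrite (cardsD1 i0) i0S in Sk.
  - move=> i; rewrite !inE negb_and negbK /u' /indic => /orP[/eqP ->|iS].
      by rewrite i0S /d; ring.
    by rewrite (negPf iS) (out _ iS); ring.
  - by move=> i; rewrite !inE /u' /indic => /andP[_ iS]; rewrite iS /d; have := hi0 i iS; lra.
apply: (main #|V| [set: V] u0 (- \Rsum_(i : V) Rabs (u0 i))); first by rewrite cardsT.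
  by move=> i; rewrite inE.
move=> i _; have := @Rsum_term _ xpredT (fun i => Rabs (u0 i)) i (fun i _ => Rabs_pos _) isT.
by have := Rle_abs (- u0 i); rewrite Rabs_Ropp; lra.
Qed.

(** For equal signs the middle term is |a - b| (|a| + |b|) >= (a - b)^2; for opposite signs it is
    a^2 + b^2 >= (a - b)^2 / 2. *)
Lemma signed_square_bounds (a b : R) :
  (a - b) ^ 2 / 2 <= Rabs (a * Rabs a - b * Rabs b) <= Rabs (a - b) * (Rabs a + Rabs b).
Proof.
have ha := Rle_abs (a * Rabs a - b * Rabs b).
have hb := Rle_abs (- (a * Rabs a - b * Rabs b)); rewrite Rabs_Ropp in hb.
split.
  move: ha hb; move: (Rabs (a * Rabs a - _)) => r.
  have [[a0 ->] | [a0 ->]] : 0 <= a /\ Rabs a = a \/ a <= 0 /\ Rabs a = - a.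
  - by case: (Rle_lt_dec 0 a) => h; [left; rewrite Rabs_right; lra | right; rewrite Rabs_left; lra].
  - have [[b0 ->] | [b0 ->]] : 0 <= b /\ Rabs b = b \/ b <= 0 /\ Rabs b = - b.
    + by case: (Rle_lt_dec 0 b) => h; [left; rewrite Rabs_right; lra | right; rewrite Rabs_left; lra].
    + by case: (Rle_lt_dec a b) => ab; nra.
    + by have := pow2_ge_0 (a + b); lra.
  - have [[b0 ->] | [b0 ->]] : 0 <= b /\ Rabs b = b \/ b <= 0 /\ Rabs b = - b.
    + by case: (Rle_lt_dec 0 b) => h; [left; rewrite Rabs_right; lra | right; rewrite Rabs_left; lra].
    + by have := pow2_ge_0 (a + b); lra.
    + by case: (Rle_lt_dec a b) => ab; nra.
have -> : a * Rabs a - b * Rabs b = (a - b) * ((Rabs a + Rabs b) / 2) +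
    ((a + b) * ((Rabs a - Rabs b) / 2)) by field.
have h1 := Rabs_triang_inv2 a b.
have h2 := Rabs_triang a b.
apply: (Rle_trans _ _ _ (Rabs_triang _ _)); rewrite /Rdiv !Rabs_mult.
rewrite (Rabs_right (/ 2)); last lra.
have pa := Rabs_pos a; have pb := Rabs_pos b.
rewrite (Rabs_right (Rabs a + Rabs b)); last lra.
have h3 : Rabs (a + b) * Rabs (Rabs a - Rabs b) <= (Rabs a + Rabs b) * Rabs (a - b).
  by apply: Rmult_le_compat => //; exact: Rabs_pos.
lra.
Qed.

(** Twice the Dirichlet form of the graph induced on W, as every edge is counted in both
    directions. *)
Definition energy A W x : R :=
  \Rsum_(i : V | i \in W) \Rsum_(j : V | j \in W) (if A i j then (x i - x j) ^ 2 else 0).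

Lemma energy_complete W x : \Rsum_(i : V | i \in W) x i = 0 ->
  \Rsum_(i : V | i \in W) \Rsum_(j : V | j \in W) ((x i - x j) ^ 2) =
  2 * INR #|W| * \Rsum_(i : V | i \in W) x i ^ 2.
Proof.
move=> x0; set X := \Rsum_(i : V | i \in W) x i ^ 2.
have e i : \Rsum_(j : V | j \in W) ((x i - x j) ^ 2) = INR #|W| * x i ^ 2 + X.
  have -> : INR #|W| * x i ^ 2 + X = INR #|W| * x i ^ 2 - 2 * x i * 0 + X by ring.
  rewrite -Rsum_const_in -x0 -Rsum_mull -Rsum_sub -Rsum_add.
  by apply: eq_bigr => j _; ring.
under eq_bigr => i _ do rewrite e.
rewrite Rsum_add Rsum_mull Rsum_const_in -/X; ring.
Qed.

Lemma sum_neighbours_le A W d x : symmetric A ->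
  (forall i, i \in W -> \Rsum_(j : V | j \in W) (if A i j then 1 else 0) <= d) ->
  \Rsum_(i : V | i \in W) \Rsum_(j : V | j \in W)
     (if A i j then (Rabs (x i) + Rabs (x j)) ^ 2 else 0)
  <= 4 * d * \Rsum_(i : V | i \in W) x i ^ 2.
Proof.
move=> sA hd.
pose T := \Rsum_(i : V | i \in W) \Rsum_(j : V | j \in W) (if A i j then x i ^ 2 else 0).
have hT : T <= d * \Rsum_(i : V | i \in W) x i ^ 2.
  rewrite -Rsum_mull; apply: Rsum_le => i iW.
  have := Rmult_le_compat_r _ _ _ (pow2_ge_0 (x i)) (hd i iW); rewrite -Rsum_mulr => h.
  by apply: Rle_trans h; apply: Req_le; apply: eq_bigr => j _; case: ifP => _; ring.
have hT' : T = \Rsum_(i : V | i \in W) \Rsum_(j : V | j \in W) (if A i j then x j ^ 2 else 0).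
  rewrite exchange_big; apply: eq_bigr => i _; apply: eq_bigr => j _.
  by rewrite sA.
suff : \Rsum_(i : V | i \in W) \Rsum_(j : V | j \in W)
     (if A i j then (Rabs (x i) + Rabs (x j)) ^ 2 else 0) <= 2 * T + 2 * T by lra.
rewrite {2}hT' /T -!Rsum_mull -Rsum_add; apply: Rsum_le => i _.
rewrite -!Rsum_mull -Rsum_add; apply: Rsum_le => j _; case: ifP => _; last lra.
have := pow2_ge_0 (Rabs (x i) - Rabs (x j)); have := pow2_abs (x i); have := pow2_abs (x j); lra.
Qed.

(* Cheeger's argument applied to x |x|, whose increments dominate those of x squared whatever
   the signs, so that no median has to be subtracted. *)
Lemma poincare A W b d x : symmetric A -> 0 < d -> 0 <= b ->
  (forall i, i \in W -> \Rsum_(j : V | j \in W) (if A i j then 1 else 0) <= d) ->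
  (forall S, b * (\Rsum_(i : V | i \in W) \Rsum_(j : V | j \in W) Rabs (indic S i - indic S j))
    <= \Rsum_(i : V | i \in W) \Rsum_(j : V | j \in W)
         (if A i j then Rabs (indic S i - indic S j) else 0)) ->
  \Rsum_(i : V | i \in W) x i = 0 ->
  (b * INR #|W|) ^ 2 * (\Rsum_(i : V | i \in W) x i ^ 2) <= 4 * d * energy A W x.
Proof.
move=> sA d0 b0 hd hcut x0; set X := \Rsum_(i : V | i \in W) x i ^ 2.
have hX : 0 <= X by apply: Rsum_ge0 => i _; exact: pow2_ge_0.
pose c i j := if (i \in W) && (j \in W) then (if A i j then 1 else 0) - b else 0.
have cE (D : V -> V -> R) : \Rsum_(i : V) \Rsum_(j : V) (c i j * D i j) =
    \Rsum_(i : V | i \in W) \Rsum_(j : V | j \in W) (if A i j then D i j else 0)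
    - b * \Rsum_(i : V | i \in W) \Rsum_(j : V | j \in W) D i j.
  rewrite -Rsum_mull -Rsum_sub [RHS]Rsum_mkcond; apply: eq_bigr => i _.
  rewrite -Rsum_mull -Rsum_sub /c; case: (i \in W) => /=; last first.
    by rewrite big1 // => j _; ring.
  by rewrite [RHS]Rsum_mkcond; apply: eq_bigr => j _; case: (j \in W); case: (A i j); ring.
have hc S : 0 <= \Rsum_(i : V) \Rsum_(j : V) (c i j * Rabs (indic S i - indic S j)).
  by rewrite cE; have := hcut S; lra.
have := cut_ineq_l1 hc (fun i => x i * Rabs (x i)); rewrite cE.
set S1 := \Rsum_(i : V | _) _; set S2 := \Rsum_(i : V | _) _ => hS.
have hS2 : INR #|W| * X <= S2.
  have <- : / 2 * (2 * INR #|W| * X) = INR #|W| * X by field.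
  rewrite -(energy_complete x0) -Rsum_mull; apply: Rsum_le => i _; rewrite -Rsum_mull.
  by apply: Rsum_le => j _; have [h _] := signed_square_bounds (x i) (x j); lra.
(* Weighted AM-GM, r y <= r^2 / (4 k) + k y^2, with k still free. *)
have hS1 k : 0 < k -> S1 <= / (4 * k) * energy A W x + k * (4 * d * X).
  move=> k0; apply: Rle_trans (Rplus_le_compat_l _ _ _
    (Rmult_le_compat_l k _ _ (Rlt_le _ _ k0) (sum_neighbours_le x sA hd))).
  rewrite /energy /S1 -!Rsum_mull -Rsum_add; apply: Rsum_le => i _.
  rewrite -!Rsum_mull -Rsum_add; apply: Rsum_le => j _; case: ifP => _; last lra.
  have [_ h] := signed_square_bounds (x i) (x j); apply: Rle_trans h _.
  set y := Rabs (x i) + _; rewrite -(pow2_abs (x i - x j)); set r := Rabs (x i - x j).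
  have -> : / (4 * k) * r ^ 2 + k * y ^ 2 = r * y + k * (r / (2 * k) - y) ^ 2 by field; lra.
  by have := Rmult_le_pos _ _ (Rlt_le _ _ k0) (pow2_ge_0 (r / (2 * k) - y)); lra.
set N := INR #|W| in hS2 *; have N0 : 0 <= N by apply: pos_INR.
have hE : 0 <= energy A W x.
  by do 2!(apply: Rsum_ge0 => ? _); case: ifP => _; [exact: pow2_ge_0 | lra].
have [bN | bN] : b * N = 0 \/ 0 < b * N by have := Rmult_le_pos _ _ b0 N0; lra.
  by rewrite bN; have := Rmult_le_pos _ _ (Rlt_le _ _ d0) hE; lra.
(* This k makes the term in X exactly half of b N X, so it can be absorbed on the left. *)
have k0 : 0 < b * N / (8 * d) by apply: Rdiv_lt_0_compat; lra.
have := hS1 _ k0.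
have -> : / (4 * (b * N / (8 * d))) = 2 * d / (b * N).
  by move: (b * N) bN => y y0; field; lra.
have -> : b * N / (8 * d) * (4 * d * X) = b * N * X / 2 by field; lra.
have := Rmult_le_compat_l _ _ _ b0 hS2 => h1 h2.
have h3 : b * N * X / 2 <= 2 * d / (b * N) * energy A W x by lra.
have := Rmult_le_compat_l _ _ _ (Rlt_le _ _ bN) h3.
have -> : b * N * (2 * d / (b * N) * energy A W x) = 2 * d * energy A W x.
  by move: (b * N) bN => y y0; field; lra.
lra.
Qed.

Lemma sum_by_parts A W (D : V -> V -> R) z : symmetric A ->
  (forall i j, D j i = - D i j) ->
  2 * (\Rsum_(i : V | i \in W) (\Rsum_(j : V | j \in W) (if A i j then D i j else 0)) * z i) =
  \Rsum_(i : V | i \in W) \Rsum_(j : V | j \in W) (if A i j then D i j * (z i - z j) else 0).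
Proof.
move=> sA aD.
set T := \Rsum_(i : V | _) _.
have hT : T = \Rsum_(i : V | i \in W) \Rsum_(j : V | j \in W) (if A i j then D i j * z i else 0).
  apply: eq_bigr => i _; rewrite -Rsum_mulr; apply: eq_bigr => j _; case: ifP => _; ring.
have hT' : T = \Rsum_(i : V | i \in W) \Rsum_(j : V | j \in W) (if A i j then - (D i j * z j) else 0).
  rewrite hT exchange_big; apply: eq_bigr => i _; apply: eq_bigr => j _.
  by rewrite sA aD; case: ifP => _; ring.
have -> : 2 * T = T + T by ring.
rewrite {1}hT hT' -Rsum_add; apply: eq_bigr => i _.
by rewrite -Rsum_add; apply: eq_bigr => j _; case: ifP => _; ring.
Qed.

(** Pair the equations with the centred difference z = u - v - mu. The logistic part gives at least
    half of [sig_slope M] times the energy of z, the penalty has the right sign, and the constants s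
    and lam mu disappear because z sums to zero. This freedom in s and mu is what allows v to be a
    translated solution. *)
Lemma logistic_stability A W M gap lam s mu u v t : symmetric A -> 0 < gap -> 0 <= lam ->
  (forall x, \Rsum_(i : V | i \in W) x i = 0 ->
    gap * (\Rsum_(i : V | i \in W) x i ^ 2) <= energy A W x) ->
  (forall i j, i \in W -> j \in W -> Rabs (u i - u j) <= M /\ Rabs (v i - v j) <= M) ->
  (forall i, i \in W ->
    \Rsum_(j : V | j \in W)
      (if A i j then sigmoid (u i - u j) - sigmoid (v i - v j) else 0)
    + lam * (u i - v i) = s + t i) ->
  \Rsum_(i : V | i \in W) (u i - v i) = INR #|W| * mu ->
  (sig_slope M * gap / 2) ^ 2 * (\Rsum_(i : V | i \in W) (u i - v i - mu) ^ 2)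
  <= \Rsum_(i : V | i \in W) t i ^ 2.
Proof.
move=> sA gap0 lam0 hgap hM heq hmu.
pose z i := u i - v i - mu.
have z0 : \Rsum_(i : V | i \in W) z i = 0 by rewrite Rsum_sub hmu Rsum_const_in; ring.
set Z := \Rsum_(i : V | i \in W) _; have ZE : Z = \Rsum_(i : V | i \in W) z i ^ 2 by [].
have hZ : 0 <= Z by apply: Rsum_ge0 => i _; exact: pow2_ge_0.
have al0 := sig_slope_gt0 M; set al := sig_slope M in al0 *.
pose D i j := sigmoid (u i - u j) - sigmoid (v i - v j).
have aD i j : D j i = - D i j.
  rewrite /D; have -> : u j - u i = - (u i - u j) by ring.
  have -> : v j - v i = - (v i - v j) by ring.
  by rewrite !sigmoidN; ring.
have hb := sum_by_parts W z sA aD.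
have hlow : al * energy A W z <= \Rsum_(i : V | i \in W) \Rsum_(j : V | j \in W)
    (if A i j then D i j * (z i - z j) else 0).
  rewrite -Rsum_mull; apply: Rsum_le => i iW; rewrite -Rsum_mull; apply: Rsum_le => j jW.
  case: ifP => _; last lra.
  have [h1 h2] := hM i j iW jW; have := sigmoid_slope h1 h2.
  have -> : u i - u j - (v i - v j) = z i - z j by rewrite /z; ring.
  by [].
have hsum : \Rsum_(i : V | i \in W) (\Rsum_(j : V | j \in W) (if A i j then D i j else 0)) * z i
    = \Rsum_(i : V | i \in W) (t i * z i) - lam * Z.
  have -> : \Rsum_(i : V | i \in W) (t i * z i) - lam * Z =
    \Rsum_(i : V | i \in W) (t i * z i) - lam * Z + (s - lam * mu) * 0 by ring.
  rewrite -[in RHS]z0 ZE -!Rsum_mull -Rsum_sub -Rsum_add; apply: eq_bigr => i iW.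
  have e : t i = \Rsum_(j : V | j \in W) (if A i j then D i j else 0) + lam * (u i - v i) - s.
    by rewrite heq //; ring.
  by rewrite e /z; ring.
set c := al * gap / 2; have c0 : 0 < c by rewrite /c; nra.
have h1 : c * Z <= \Rsum_(i : V | i \in W) (t i * z i).
  have := hgap z z0; rewrite -ZE => /(Rmult_le_compat_l _ _ _ (Rlt_le _ _ al0)) hg.
  by have := Rmult_le_pos _ _ lam0 hZ; rewrite /c; lra.
have h2 : 2 * c * (\Rsum_(i : V | i \in W) (t i * z i)) <=
    \Rsum_(i : V | i \in W) t i ^ 2 + c ^ 2 * Z.
  rewrite ZE -!Rsum_mull -Rsum_add; apply: Rsum_le => i _.
  by have := pow2_ge_0 (t i - c * z i); lra.
have := Rmult_le_compat_l (2 * c) _ _ ltac:(lra) h1; lra.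
Qed.

End Graph.

(** * Stationarity of minimisers of the likelihood *)

Section Likelihood.
Variables (n L : nat).
Notation outc := (outcome n L).
Implicit Types (o : outc) (i j k : 'I_n) (th x : 'I_n -> R).

(** The partial derivative in coordinate i of the likelihood loss without its penalty. *)
Definition score o x i : R :=
  \Rsum_(j : 'I_n) (if adj o i j then sigmoid (x i - x j) - win_freq o i j else 0).

Lemma ybar01 o i j : (0 < L)%N -> 0 <= ybar o i j <= 1.
Proof.
move=> /ltP/lt_0_INR L0; rewrite /ybar; set S := (X in X / _).
have S0 : 0 <= S by apply: Rsum_ge0 => l _; case: ifP => _; lra.
have S1 : S <= INR L.
  have -> : INR L = \Rsum_(l : 'I_L) 1 by rewrite Rsum_constT card_ord; ring.
  by apply: Rsum_le => l _; case: ifP => _; lra.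
split; first by apply: Rmult_le_pos => //; apply/Rlt_le/Rinv_0_lt_compat.
by apply: (Rmult_le_reg_r (INR L)) => //; rewrite /Rdiv Rmult_assoc Rinv_l; lra.
Qed.

Lemma Lreg_ge0 o lam x : (0 < L)%N -> 0 <= lam -> 0 <= Lreg o lam x.
Proof.
move=> L0 lam0; apply: Rplus_le_le_0_compat.
  apply: Rsum_ge0 => i _; apply: Rsum_ge0 => j _; have := ybar01 o i j L0.
  have := softplus_gt (x i - x j); have := softplus_ge0 (x i - x j); rewrite /softplus.
  by move: (x i - x j) (ln _) (ybar _ _ _) => u s y h1 h2 hy; nra.
apply: Rmult_le_pos; first lra.
by apply: Rsum_ge0 => i _; exact: pow2_ge_0.
Qed.

Definition shift_coord x k (t : R) : 'I_n -> R := fun i => x i + (if i == k then t else 0).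

(** A crude smoothness constant: at most n^2 pairs, each adding at most t^2 by [softplus_smooth];
    the 1 keeps it positive. *)
Definition curvature (lam : R) : R := INR n * INR n + lam + 1.

(** The left-hand side is the directional derivative of the loss along t times the k-th unit
    vector. *)
Lemma score_direction o x k t :
  \Rsum_(i : 'I_n) \Rsum_(j : 'I_n | (j < i)%N && o.1 i j)
    ((sigmoid (x i - x j) - (1 - ybar o i j)) * ((if i == k then t else 0) - (if j == k then t else 0)))
  = t * score o x k.
Proof.
pose G i j := if adj o i j then
  (sigmoid (x i - x j) - win_freq o i j) * (if i == k then t else 0) else 0.
have -> : t * score o x k = \Rsum_(i : 'I_n) \Rsum_(j : 'I_n) G i j.
  rewrite (bigD1 k) //= [X in _ = _ + X]big1 => [|i ik].
    rewrite Rplus_0_r -Rsum_mull; apply: eq_bigr => j _; rewrite /G eqxx.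
    by case: ifP => _; ring.
  by apply: big1 => j _; rewrite /G (negPf ik); case: ifP => _; ring.
rewrite double_sum_lower => [|i]; last by rewrite /G adj_irr.
apply: eq_bigr => i _; rewrite big_mkcondr; apply: eq_bigr => j ji.
have ij : i != j by rewrite -val_eqE gtn_eqF.
rewrite /G (adj_sym o j i) (win_freqC o ij) {1 2}/adj ji.
have -> : win_freq o i j = 1 - ybar o i j by rewrite /win_freq ji.
case: ifP => _; last lra.
have -> : x j - x i = - (x i - x j) by ring.
by rewrite sigmoidN; ring.
Qed.

Lemma Lreg_shift o lam x k t : 0 <= lam ->
  Lreg o lam (shift_coord x k t) <=
  Lreg o lam x + t * (score o x k + lam * x k) + curvature lam * t ^ 2.
Proof.
move=> lam0; pose d i := if i == k then t else 0.
have hreg : \Rsum_(i : 'I_n) (shift_coord x k t i ^ 2) =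
    \Rsum_(i : 'I_n) (x i ^ 2) + 2 * t * x k + t ^ 2.
  rewrite (bigD1 k) //= [\Rsum_(i : 'I_n) (x i ^ 2)](bigD1 k) //= /shift_coord eqxx.
  under eq_bigr => i ik do rewrite (negPf ik) Rplus_0_r.
  by set S := (X in _ + X); rewrite -/S; ring.
have hloss : \Rsum_(i : 'I_n) \Rsum_(j : 'I_n | (j < i)%N && o.1 i j)
     (- (1 - ybar o i j) * (shift_coord x k t i - shift_coord x k t j)
      + ln (1 + exp (shift_coord x k t i - shift_coord x k t j))) <=
   \Rsum_(i : 'I_n) \Rsum_(j : 'I_n | (j < i)%N && o.1 i j)
     (- (1 - ybar o i j) * (x i - x j) + ln (1 + exp (x i - x j)))
   + t * score o x k + INR n * INR n * t ^ 2.
  have -> : INR n * INR n * t ^ 2 = \Rsum_(i : 'I_n) \Rsum_(j : 'I_n) (t ^ 2).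
    by rewrite !Rsum_constT !card_ord; ring.
  rewrite -score_direction -!Rsum_add; apply: Rsum_le => i _.
  have h : \Rsum_(j : 'I_n | (j < i)%N && o.1 i j) (t ^ 2) <= \Rsum_(j : 'I_n) (t ^ 2).
    by apply: Rsum_le_mask => j; exact: pow2_ge_0.
  apply: Rle_trans (Rplus_le_compat_l _ _ _ h).
  rewrite -!Rsum_add; apply: Rsum_le => j _; rewrite /shift_coord -/(d i) -/(d j).
  have -> : x i + d i - (x j + d j) = x i - x j + (d i - d j) by ring.
  have := softplus_smooth (x i - x j) (d i - d j); rewrite /softplus.
  have : (d i - d j) ^ 2 <= t ^ 2.
    by rewrite /d; case: ifP => _; case: ifP => _; have := pow2_ge_0 t; lra.
  by lra.
rewrite /Lreg hreg /curvature.
by have := Rmult_le_pos _ _ lam0 (pow2_ge_0 t); have := pow2_ge_0 t; lra.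
Qed.

(** A gradient step of length g / (2 K) in coordinate k, K being the curvature, lowers the objective
    by at least g^2 / (4 K), which cannot exceed e. The case e = 0 yields stationarity without
    differentiating. *)
Lemma near_min_stationary o lam x e k : 0 <= lam ->
  (forall x', Lreg o lam x <= Lreg o lam x' + e) ->
  (score o x k + lam * x k) ^ 2 <= 4 * curvature lam * e.
Proof.
move=> lam0 hx; set g := score o x k + _.
have K0 : 0 < curvature lam by rewrite /curvature; have := pos_INR n; nra.
have := Rle_trans _ _ _ (hx _) (Rplus_le_compat_r e _ _
  (Lreg_shift o x k (- g / (2 * curvature lam)) lam0)); rewrite -/g.
have -> : curvature lam * (- g / (2 * curvature lam)) ^ 2 = g ^ 2 * / (4 * curvature lam).
  by field; lra.
have -> : - g / (2 * curvature lam) * g = - 2 * (g ^ 2 * / (4 * curvature lam)).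
  by field; lra.
move=> h; have {}h : g ^ 2 * / (4 * curvature lam) <= e by lra.
have := Rmult_le_compat_l (4 * curvature lam) _ _ ltac:(lra) h.
have -> : 4 * curvature lam * (g ^ 2 * / (4 * curvature lam)) = g ^ 2 by field; lra.
by [].
Qed.

Lemma regMLE_stationary o lam th k : 0 <= lam -> is_regMLE o lam th ->
  score o th k + lam * th k = 0.
Proof.
move=> lam0 hth.
have := @near_min_stationary o lam th 0 k lam0; rewrite Rmult_0_r => h.
have := h (fun x' => ltac:(rewrite Rplus_0_r; exact: hth)).
by move=> {}h; apply: Rsqr_0_uniq; rewrite Rsqr_pow2; have := pow2_ge_0 (score o th k + lam * th k); lra.
Qed.

Lemma approx_stationary o lam eta : (0 < L)%N -> 0 <= lam -> 0 < eta ->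
  exists x : 'I_n -> R, forall k, Rabs (score o x k + lam * x k) <= eta.
Proof.
move=> L0 lam0 eta0.
have K0 : 0 < curvature lam by rewrite /curvature; have := pos_INR n; nra.
pose E r := exists x : 'I_n -> R, r = - Lreg o lam x.
have [||m [ub lub]] := completeness E.
- by exists 0 => r [x ->]; have := Lreg_ge0 o x L0 lam0; lra.
- by exists (- Lreg o lam (fun=> 0)); exists (fun=> 0).
(* A point within e of the infimum has squared gradient entries at most 4 K e = eta^2. *)
pose e := eta ^ 2 / (4 * curvature lam).
have e0 : 0 < e by apply: Rdiv_lt_0_compat; [apply: pow_lt | lra].
have [x hx] : exists x : 'I_n -> R, m - e < - Lreg o lam x.
  apply: NNPP => h; have := lub (m - e); suff hub : is_upper_bound E (m - e).
    by move=> /(_ hub); lra.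
  by move=> r [x ->]; apply: Rnot_lt_le => hr; apply: h; exists x.
exists x => k.
have hmin x' : Lreg o lam x <= Lreg o lam x' + e.
  by have := ub (- Lreg o lam x') (ex_intro _ x' (erefl _)); lra.
have := near_min_stationary k lam0 hmin.
have -> : 4 * curvature lam * e = eta ^ 2 by rewrite /e; field; lra.
move=> h; apply: Rsqr_incr_0_var; last lra.
by rewrite -Rsqr_abs !Rsqr_pow2.
Qed.

End Likelihood.

(** * Deterministic leave-one-out bound *)

Lemma supnorm_ge0 n (v : 'I_n -> R) : 0 <= supnorm v.
Proof.
apply: big_ind => [|y z hy hz|i _]; [lra | | exact: Rabs_pos].
exact: Rle_trans hy (Rmax_l _ _).
Qed.

Lemma supnorm_term n (v : 'I_n -> R) i : Rabs (v i) <= supnorm v.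
Proof.
rewrite /supnorm; have := mem_index_enum i.
elim: (index_enum _) => // k s IH; rewrite inE big_cons => /orP[/eqP <-|/IH h].
  exact: Rmax_l.
exact: Rle_trans h (Rmax_r _ _).
Qed.

Lemma supnorm_le n (v : 'I_n -> R) c : 0 <= c -> (forall i, Rabs (v i) <= c) -> supnorm v <= c.
Proof. by move=> c0 h; apply: (big_ind (fun y => y <= c)) => // y z; apply: Rmax_lub. Qed.

Section Deterministic.
Variable n : nat.
Notation I := ('I_n).
Implicit Types (A : rel I) (Y : I -> I -> R) (u x ths th : I -> R) (i j m : I) (W : {set I}).

(** For [adj] and [win_freq] this is [score]. Leaving Y free makes it possible to exchange wins and
    losses. *)
Definition residual A Y u i : R :=
  \Rsum_(j : I) (if A i j then sigmoid (u i - u j) - Y i j else 0).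

Definition noise A Y ths i : R :=
  \Rsum_(j : I) (if A i j then Y i j - sigmoid (ths i - ths j) else 0).

(* At a maximum of u - ths the logistic terms of the score exceed their true values, so the
   penalty alone controls u there. *)
Lemma max_principle_upper A Y ths u lam G eta T : 0 < lam ->
  (forall i, residual A Y u i + lam * u i <= eta) ->
  (forall i, noise A Y ths i <= G) -> (forall i, Rabs (ths i) <= T) ->
  forall i, u i <= (G + eta) / lam + 2 * T.
Proof.
move=> lam0 hu hG hT i.
have [k hk] := fin_argmax (fun i => u i - ths i) i.
have huk : u k <= (G + eta) / lam.
  apply: (Rmult_le_reg_l lam) => //.
  have -> : lam * ((G + eta) / lam) = G + eta by field; lra.
  have : 0 <= residual A Y u k + noise A Y ths k.
    rewrite -Rsum_add; apply: Rsum_ge0 => j _; case: ifP => _; last lra.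
    have : sigmoid (ths k - ths j) <= sigmoid (u k - u j) by apply: sigmoid_le; have := hk j; lra.
    lra.
  by have := hu k; have := hG k; lra.
have hi := hk i; have hTk := Rabs_bounds (hT k); have hTi := Rabs_bounds (hT i); lra.
Qed.

(** Negating the scores while exchanging wins and losses is a symmetry of the problem; it turns the
    upper bound of the maximum principle into the lower one. *)
Lemma residualN A Y u i :
  residual A (fun i j => 1 - Y i j) (fun i => - u i) i = - residual A Y u i.
Proof.
rewrite -Rsum_opp; apply: eq_bigr => j _; case: ifP => _; last lra.
have -> : - u i - - u j = - (u i - u j) by ring.
by rewrite sigmoidN; ring.
Qed.

Lemma noiseN A Y ths i :
  noise A (fun i j => 1 - Y i j) (fun i => - ths i) i = - noise A Y ths i.
Proof.
rewrite -Rsum_opp; apply: eq_bigr => j _; case: ifP => _; last lra.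
have -> : - ths i - - ths j = - (ths i - ths j) by ring.
by rewrite sigmoidN; ring.
Qed.

Lemma max_principle A Y ths u lam G eta T : 0 < lam ->
  (forall i, Rabs (residual A Y u i + lam * u i) <= eta) ->
  (forall i, Rabs (noise A Y ths i) <= G) -> (forall i, Rabs (ths i) <= T) ->
  forall i, Rabs (u i) <= (G + eta) / lam + 2 * T.
Proof.
move=> lam0 hu hG hT i; apply: Rabs_le.
have h1 := @max_principle_upper A Y ths u lam G eta T lam0
  (fun i => proj2 (Rabs_bounds (hu i))) (fun i => proj2 (Rabs_bounds (hG i))) hT i.
have := @max_principle_upper A (fun i j => 1 - Y i j) (fun i => - ths i) (fun i => - u i)
  lam G eta T lam0 _ _ _ i.
move=> h; have {}h : - u i <= (G + eta) / lam + 2 * T; last lra.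
apply: h => k.
- by rewrite residualN; have := Rabs_bounds (hu k); lra.
- by rewrite noiseN; have := Rabs_bounds (hG k); lra.
- by rewrite Rabs_Ropp.
Qed.

Variables (A : rel I) (Y : I -> I -> R) (ths th : I -> R) (p T clam B r ell c0 : R).
Let a : R := INR n * p.
Let lam : R := clam * B.
(** Twice 20 / clam + 2 T, which bounds theta and the untranslated leave-one-out solutions, so it
    bounds differences of scores. The 20 is 19 for the noise without one item plus 1 for the
    approximation error, both in units of B. *)
Definition slope_range (clam T : R) : R := 40 / clam + 4 * T.
Let M : R := slope_range clam T.
Let al : R := sig_slope M.
(** 1536 = 2 * 768 inverts the stability constant al (a / 768) / 2, and 10 + clam T bounds noise
    plus penalty in units of B. *)
Definition l2_const (clam T : R) : R := 1536 * (10 + clam * T) / sig_slope (slope_range clam T).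
Definition loo_const (clam T : R) : R := 76800 / sig_slope (slope_range clam T) + 2.
Let C2 : R := l2_const clam T.
Let C3 : R := loo_const clam T.

(** The properties of a good outcome. The noise of one edge has scale r and that of a row of about a
    edges has scale B = sqrt a * r. Cuts are controlled on every vertex set missing at most one
    item, which covers the full graph and all leave-one-out graphs. *)
Hypotheses (n_gt1 : (1 < n)%N) (p_gt0 : 0 < p) (p_le1 : p <= 1) (a_ge1 : 1 <= a)
  (T_ge0 : 0 <= T) (clam_gt0 : 0 < clam) (B_gt0 : 0 < B) (r_gt0 : 0 < r)
  (B_sqr : B ^ 2 = a * r ^ 2) (symA : symmetric A) (irrA : forall i, A i i = false)
  (ths_le : forall i, Rabs (ths i) <= T) (ths_sum : \Rsum_(i : I) ths i = 0)
  (degree_le : forall i, \Rsum_(j : I) (if A i j then 1 else 0) <= 3 * a)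
  (noise_le : forall i, Rabs (noise A Y ths i) <= 10 * B)
  (edge_noise_le : forall i j, A i j -> Rabs (Y i j - sigmoid (ths i - ths j)) <= 9 * r)
  (YC : forall i j, A i j -> Y j i = 1 - Y i j)
  (cut_ge : forall W S : {set I}, (n <= #|W|.+1)%N ->
     p / 4 * (\Rsum_(i : I | i \in W) \Rsum_(j : I | j \in W) Rabs (indic S i - indic S j))
     <= \Rsum_(i : I | i \in W) \Rsum_(j : I | j \in W)
          (if A i j then Rabs (indic S i - indic S j) else 0))
  (th_eq : forall i, residual A Y th i + lam * th i = 0).

Lemma INRn_ge2 : 2 <= INR n.
Proof. by have := le_INR 2 n; rewrite /=; move=> h; apply: Rle_trans (h _); [lra | apply/leP]. Qed.

Lemma lam_gt0 : 0 < lam. Proof. exact: Rmult_lt_0_compat. Qed.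

Lemma al_gt0 : 0 < al. Proof. exact: sig_slope_gt0. Qed.

Lemma M_ge : 20 / clam + 2 * T <= M / 2.
Proof. by rewrite /M /slope_range; lra. Qed.

Lemma clam_inv_gt0 : 0 < 20 / clam.
Proof. by apply: Rdiv_lt_0_compat; lra. Qed.

Lemma M_ge0 : 0 <= M.
Proof. by have := M_ge; have := clam_inv_gt0; lra. Qed.

Lemma al_le1 : al <= 1.
Proof. exact: sig_slope_le1 M_ge0. Qed.

Lemma th_le i : Rabs (th i) <= 20 / clam + 2 * T.
Proof.
have := @max_principle A Y ths th lam (10 * B) 0 T lam_gt0 _ noise_le ths_le i.
have h k : Rabs (residual A Y th k + lam * th k) <= 0 by rewrite th_eq Rabs_R0; lra.
move=> /(_ h) {}h; have e : (10 * B + 0) / lam = 10 / clam by rewrite /lam; field; lra.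
have : 10 / clam <= 20 / clam; last by lra.
by apply: Rmult_le_compat_r; [exact/Rlt_le/Rinv_0_lt_compat | lra].
Qed.

Lemma th_diff_le i j : Rabs (th i - th j) <= M.
Proof.
have := M_ge; have := Rabs_bounds (th_le i); have := Rabs_bounds (th_le j) => h1 h2 h3.
by apply: Rabs_le; lra.
Qed.

Lemma ths_diff_le i j : Rabs (ths i - ths j) <= M.
Proof.
have := M_ge; have := Rabs_bounds (ths_le i); have := Rabs_bounds (ths_le j) => h1 h2 h3.
by have := clam_inv_gt0; move=> h4; apply: Rabs_le; lra.
Qed.

Lemma ths_th_diff_le i j : Rabs (ths i - th j) <= M.
Proof.
have := M_ge; have := Rabs_bounds (ths_le i); have := Rabs_bounds (th_le j) => h1 h2 h3.
by have := clam_inv_gt0; move=> h4; apply: Rabs_le; lra.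
Qed.

Lemma spectral_gap W x : (n <= #|W|.+1)%N -> \Rsum_(i : I | i \in W) x i = 0 ->
  a / 768 * (\Rsum_(i : I | i \in W) x i ^ 2) <= energy A W x.
Proof.
move=> Wn x0; set X := \Rsum_(i : I | i \in W) x i ^ 2.
have hX : 0 <= X by apply: Rsum_ge0 => i _; exact: pow2_ge_0.
have := @poincare _ A W (p / 4) (3 * a) x symA ltac:(lra) ltac:(lra) _ (fun S => cut_ge S Wn) x0.
rewrite -/X => h.
have {}h : (p / 4 * INR #|W|) ^ 2 * X <= 4 * (3 * a) * energy A W x.
  apply: h => i iW; apply: Rle_trans (degree_le i); apply: Rsum_le_mask => j.
  by case: ifP => _; lra.
have n2 := INRn_ge2.
(* |W| >= n - 1 >= n / 2. The resulting bound (a / 8)^2 X <= 12 a * energy explains 768 = 12 *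
   64. *)
have hW : a / 2 <= p * INR #|W|.
  have : INR n <= INR #|W|.+1 by apply: le_INR; apply/leP.
  by rewrite S_INR /a; nra.
have h2 : (a / 8) ^ 2 * X <= (p / 4 * INR #|W|) ^ 2 * X.
  by apply: Rmult_le_compat_r => //; apply: pow_incr; lra.
apply: (Rmult_le_reg_l (12 * a)); first lra.
by lra.
Qed.

Definition bias i : R := noise A Y ths i - lam * ths i.

Lemma bias_le i : Rabs (bias i) <= (10 + clam * T) * B.
Proof.
have h1 := Rabs_bounds (noise_le i); have h2 := Rabs_bounds (ths_le i).
have hl := lam_gt0; rewrite /bias; apply: Rabs_le; rewrite /lam in hl *; split; nra.
Qed.

Lemma th_ths_eq i :
  \Rsum_(j : I) (if A i j then sigmoid (th i - th j) - sigmoid (ths i - ths j) else 0)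
  + lam * (th i - ths i) = bias i.
Proof.
have -> : \Rsum_(j : I) (if A i j then sigmoid (th i - th j) - sigmoid (ths i - ths j) else 0) =
   residual A Y th i + noise A Y ths i.
  by rewrite -Rsum_add; apply: eq_bigr => j _; case: ifP => _; ring.
by rewrite /bias; have := th_eq i; lra.
Qed.

(** The residuals cancel in pairs, so summing the stationarity equations leaves only lam times the
    sum. The penalty thus centres theta, which is why it estimates the centred scores. *)
Lemma th_sum : \Rsum_(i : I) th i = 0.
Proof.
have h : \Rsum_(i : I) residual A Y th i = 0.
  rewrite double_sum_lower => [|i]; last by rewrite irrA.
  rewrite big1 // => i _; rewrite big1 // => j _; rewrite (symA j i); case: ifP => Aij; last lra.
  have -> : th j - th i = - (th i - th j) by ring.
  by rewrite (YC Aij) sigmoidN; ring.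
have : \Rsum_(i : I) (residual A Y th i + lam * th i) = 0.
  by rewrite big1.
rewrite Rsum_add h Rsum_mull Rplus_0_l => e; have hl := lam_gt0.
by apply: (Rmult_eq_reg_l lam); [rewrite e Rmult_0_r | lra].
Qed.

Let rho : R := B / a.

Lemma a_gt0 : 0 < a. Proof. by lra. Qed.

Lemma rho_gt0 : 0 < rho. Proof. exact: Rdiv_lt_0_compat B_gt0 a_gt0. Qed.

Lemma stability_const_gt0 : 0 < (al * (a / 768) / 2) ^ 2.
Proof.
have ha := a_gt0; apply: pow_lt; apply: Rdiv_lt_0_compat; last lra.
by apply: Rmult_lt_0_compat; [exact: al_gt0 | lra].
Qed.

Lemma setT_large : (n <= #|[set: I]|.+1)%N.
Proof. by rewrite cardsT card_ord. Qed.

(** Stability on the full graph, with s = mu = 0 because theta and the true scores are both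
    centred. *)
Lemma l2_error : \Rsum_(i : I) (th i - ths i) ^ 2 <= INR n * (C2 * rho) ^ 2.
Proof.
have := @logistic_stability _ A [set: I] M (a / 768) lam 0 0 th ths bias symA _ (Rlt_le _ _ lam_gt0) _ _ _ _.
have e (F : I -> R) : \Rsum_(i : I | i \in [set: I]) F i = \Rsum_(i : I) F i.
  by apply: eq_bigl => i; rewrite inE.
move=> h; have {}h := h ltac:(have := a_gt0; lra) (fun x => @spectral_gap _ x setT_large)
  (fun i j _ _ => conj (th_diff_le i j) (ths_diff_le i j)).
have {h} := h _ _; rewrite !e => h.
have {}h : (sig_slope M * (a / 768) / 2) ^ 2 * (\Rsum_(i : I) (th i - ths i - 0) ^ 2) <=
    \Rsum_(i : I) bias i ^ 2.
  apply: h; first by move=> i _; rewrite e th_ths_eq; lra.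
  by rewrite Rsum_sub th_sum ths_sum; lra.
have hb : \Rsum_(i : I) bias i ^ 2 <= INR n * ((10 + clam * T) * B) ^ 2.
  have -> : INR n = INR #|I| by rewrite card_ord.
  rewrite -Rsum_constT; apply: Rsum_le => i _; rewrite -(pow2_abs (bias i)).
  by apply: pow_incr; split; [exact: Rabs_pos | exact: bias_le].
have {}h := Rle_trans _ _ _ h hb; rewrite -/al in h.
have ha := a_gt0; have hal := al_gt0.
have c0' := stability_const_gt0.
apply: (Rmult_le_reg_l _ _ _ c0').
have -> : (al * (a / 768) / 2) ^ 2 * (INR n * (C2 * rho) ^ 2) = INR n * ((10 + clam * T) * B) ^ 2.
  by rewrite /C2 /l2_const /rho -/M -/al; field; split; lra.
apply: Rle_trans h; apply: Req_le; congr (_ * _); apply: eq_bigr => i _; ring.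
Qed.

(** * Comparison with a leave-one-out solution *)

Section LeaveOneOut.
Variables (m : I) (x : I -> R) (s eta D : R).
Hypotheses (x_m : x m = ths m) (x_sum : \Rsum_(i : I) x i = 0)
  (x_diff : forall i j, i != m -> j != m -> Rabs (x i - x j) <= M)
  (x_eq : forall i, i != m ->
     Rabs (\Rsum_(j : I | j != m) (if A i j then sigmoid (x i - x j) - Y i j else 0)
           + lam * x i - s) <= eta)
  (eta_ge0 : 0 <= eta) (eta_le : INR n * eta ^ 2 <= B ^ 2)
  (D_max : forall i, Rabs (th i - ths i) <= D).

Lemma D_ge0 : 0 <= D.
Proof. exact: Rle_trans (Rabs_pos _) (D_max m). Qed.

Definition loo_error : R := C3 * (D / sqrt a + rho).

(** What separates the equations of theta and x in row i: the edge to m, which x does not see, and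
    the inexactness of x. *)
Let t i : R := - (if A i m then sigmoid (th i - th m) - Y i m else 0) -
  (\Rsum_(j : I | j != m) (if A i j then sigmoid (x i - x j) - Y i j else 0) + lam * x i - s).

(** On an edge to m the logistic term moves by at most 2 D and the noise is at most 9 r, hence a
    square of at most 8 D^2 + 162 r^2. Doubling this to separate the inexactness and counting at
    most 3 a neighbours gives 48 and 972; the inexactness adds 2. *)
Lemma loo_rhs : \Rsum_(i : I | i \in [set~ m]) t i ^ 2 <= 48 * a * D ^ 2 + 974 * B ^ 2.
Proof.
have D0 := D_ge0.
have h i : i \in [set~ m] ->
    t i ^ 2 <= (if A m i then 1 else 0) * (16 * D ^ 2 + 324 * r ^ 2) + 2 * eta ^ 2.
  rewrite !inE => im; have := x_eq im; rewrite /t; move: (_ - s) => q hq.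
  have hq2 : q ^ 2 <= eta ^ 2 by rewrite -pow2_abs; apply: pow_incr; split => //; exact: Rabs_pos.
  rewrite symA; case: ifP => Ami; last by have -> : (- 0 - q) ^ 2 = q ^ 2; [ring | have := pow2_ge_0 eta; nra].
  set y := sigmoid _ - _.
  have hy : Rabs y <= 2 * D + 9 * r.
    have Aim : A i m by rewrite symA.
    have -> : y = (sigmoid (th i - th m) - sigmoid (ths i - ths m)) -
        (Y i m - sigmoid (ths i - ths m)) by rewrite /y; ring.
    have h1 := Rabs_bounds (edge_noise_le Aim).
    have h2 := Rabs_bounds (sigmoid_lip (th i - th m) (ths i - ths m)).
    have h3 : Rabs (th i - th m - (ths i - ths m)) <= 2 * D.
      by have := Rabs_bounds (D_max i); have := Rabs_bounds (D_max m) => g1 g2; apply: Rabs_le; lra.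
    by apply: Rabs_le; lra.
  have hy2 : y ^ 2 <= (2 * D + 9 * r) ^ 2.
    by rewrite -pow2_abs; apply: pow_incr; split => //; exact: Rabs_pos.
  have := pow2_ge_0 (y - q); have := pow2_ge_0 (2 * D - 9 * r); lra.
apply: (Rle_trans _ _ _ (Rsum_le h)).
rewrite Rsum_add Rsum_mulr.
have h1 : \Rsum_(i : I | i \in [set~ m]) (if A m i then 1 else 0) <= 3 * a.
  apply: Rle_trans (degree_le m); apply: Rsum_le_mask => j; case: ifP => _; lra.
have h2 : \Rsum_(i : I | i \in [set~ m]) (2 * eta ^ 2) <= INR n * (2 * eta ^ 2).
  have -> : INR n = INR #|I| by rewrite card_ord.
  rewrite -Rsum_constT; apply: Rsum_le_mask => i; have := pow2_ge_0 eta; lra.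
have h3 : 0 <= 16 * D ^ 2 + 324 * r ^ 2 by have := pow2_ge_0 D; have := pow2_ge_0 r; lra.
apply: Rle_trans (Rplus_le_compat _ _ _ _ (Rmult_le_compat_r _ _ _ h3 h1) h2) _.
by have := eta_le; rewrite B_sqr; lra.
Qed.

(** Both vectors sum to zero over all items, so the mean difference over the others is fixed by the
    difference th m - ths m at item m. *)
Lemma loo_mean : \Rsum_(i : I | i \in [set~ m]) (th i - x i) =
  INR #|[set~ m]| * (- (th m - ths m) / INR #|[set~ m]|).
Proof.
have n0 : INR #|[set~ m]| <> 0.
  have -> : #|[set~ m]| = n.-1 by rewrite cardsC1 card_ord.
  by apply: not_0_INR; case: n n_gt1 => [|[|k]].
have e (F : I -> R) : \Rsum_(i : I | i \in [set~ m]) F i = \Rsum_(i : I) F i - F m.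
  rewrite (eq_bigl (fun i => i != m)) => [|i]; last by rewrite !inE.
  by rewrite [X in _ = X - _](bigD1 m) //=; set Z := (X in X = _); rewrite -/Z; ring.
by rewrite e Rsum_sub th_sum x_sum x_m; field.
Qed.

Lemma loo_l2 : \Rsum_(i : I | i \in [set~ m]) (th i - x i) ^ 2 <= loo_error ^ 2.
Proof.
set W := [set~ m]; have D0 := D_ge0; have n2 := INRn_ge2.
have ha := a_gt0; have hal := al_gt0; have hrho := rho_gt0.
have WC : #|W| = n.-1 by rewrite cardsC1 card_ord.
have Wn : (n <= #|W|.+1)%N by rewrite WC leqSpred.
have NE : INR #|W| = INR n - 1 by rewrite WC; case: n n_gt1 => // k _; rewrite S_INR /=; ring.
set mu := - (th m - ths m) / INR #|W|.
have := @logistic_stability _ A W M (a / 768) lam (- s) mu th x t symA ltac:(lra)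
  (Rlt_le _ _ lam_gt0) (fun x => @spectral_gap W x Wn) _ _ loo_mean.
move=> h; have {}h : (sig_slope M * (a / 768) / 2) ^ 2 * (\Rsum_(i : I | i \in W) (th i - x i - mu) ^ 2) <=
    \Rsum_(i : I | i \in W) t i ^ 2.
  apply: h => [i j|i]; rewrite !inE => im.
    by move=> jm; split; [exact: th_diff_le | exact: x_diff].
  have := th_eq i; rewrite /residual (bigD1 m) //= /t.
  have -> : \Rsum_(j : I | j \in W) (if A i j then sigmoid (th i - th j) - sigmoid (x i - x j) else 0) =
    \Rsum_(j : I | j != m) (if A i j then sigmoid (th i - th j) - Y i j else 0) -
    \Rsum_(j : I | j != m) (if A i j then sigmoid (x i - x j) - Y i j else 0).
    rewrite -Rsum_sub (eq_bigl (fun j => j != m)) => [|j]; last by rewrite !inE.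
    by apply: eq_bigr => j _; case: ifP => _; ring.
  move=> hth; set P := (X in X - _ + _ = _); set Q := (X in _ - X + _ = _).
  by rewrite -/P in hth; rewrite -/Q; lra.
have {}h := Rle_trans _ _ _ h loo_rhs; rewrite -/al in h.
set Z := \Rsum_(i : I | _) _ in h.
have hZ : Z <= (1536 / al) ^ 2 * (48 * (D ^ 2 / a) + 974 * rho ^ 2).
  have c0' := stability_const_gt0.
  apply: (Rmult_le_reg_l _ _ _ c0'); apply: Rle_trans h _; apply: Req_le.
  by rewrite /rho; field; split; lra.
have hmu : INR #|W| * mu ^ 2 <= 2 * (D ^ 2 / a).
  have -> : INR #|W| * mu ^ 2 = (th m - ths m) ^ 2 / (INR n - 1).
    by rewrite /mu NE; field; lra.
  have h1 : (th m - ths m) ^ 2 <= D ^ 2.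
    by rewrite -pow2_abs; apply: pow_incr; split; [exact: Rabs_pos | exact: D_max].
  (* Since p <= 1, a / 2 <= n / 2 <= n - 1. *)
  have h2 : / (INR n - 1) <= 2 / a.
    have -> : 2 / a = / (a / 2) by field; lra.
    by apply: Rinv_le_contravar; rewrite /a; nra.
  have -> : 2 * (D ^ 2 / a) = D ^ 2 * (2 / a) by field; lra.
  apply: Rmult_le_compat => //; first exact: pow2_ge_0.
  by apply/Rlt_le/Rinv_0_lt_compat; lra.
have hsum : \Rsum_(i : I | i \in W) (th i - x i) ^ 2 <= 2 * Z + 2 * (INR #|W| * mu ^ 2).
  rewrite -Rsum_const_in -!Rsum_mull -Rsum_add; apply: Rsum_le => i _.
  by have := pow2_ge_0 (th i - x i - mu - mu); lra.
apply: (Rle_trans _ _ _ hsum).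
have hD2 : 0 <= D ^ 2 / a by apply: Rmult_le_pos; [exact: pow2_ge_0 | exact/Rlt_le/Rinv_0_lt_compat].
have hal1 : 1 <= 1 / al by apply: (Rmult_le_reg_r al) => //; have := al_le1; rewrite /Rdiv Rmult_assoc Rinv_l; lra.
(* 76800 = 50 * 1536, with 50^2 >= 2 * 974; the summand 2 in C3 pays for the 4. *)
have hC3 : 2 * (1536 / al) ^ 2 * 974 + 4 <= C3 ^ 2.
  rewrite /C3 /loo_const -/M -/al; have -> : 76800 / al = 50 * (1536 / al) by field; lra.
  set y := 1536 / al; have : 0 < y by apply: Rdiv_lt_0_compat; lra.
  by nra.
have hq : 0 < sqrt a by apply: sqrt_lt_R0.
have hqq : sqrt a ^ 2 = a by rewrite pow2_sqrt; lra.
have -> : loo_error ^ 2 = C3 ^ 2 * (D ^ 2 / a + 2 * (D / sqrt a) * rho + rho ^ 2).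
  by rewrite /loo_error -{2}hqq; field; lra.
have hx : 0 <= 2 * (D / sqrt a) * rho.
  by apply: Rmult_le_pos; [apply: Rmult_le_pos; [lra | apply: Rmult_le_pos; [|exact/Rlt_le/Rinv_0_lt_compat]] | lra].
have hr2 := pow2_ge_0 rho.
apply: Rle_trans (_ : (2 * (1536 / al) ^ 2 * 974 + 4) * (D ^ 2 / a + rho ^ 2) <= _); last first.
  by apply: Rmult_le_compat => //; have := pow2_ge_0 (1536 / al); lra.
have := Rmult_le_pos _ _ (pow2_ge_0 (1536 / al)) hD2; lra.
Qed.

Hypotheses (D_m : Rabs (th m - ths m) = D) (ell_ge0 : 0 <= ell) (c0_gt0 : 0 < c0)
  (ell_le : ell <= a / c0) (c0_ge : 256 * (1 + C3) / al <= c0) (a_ge : c0 / 2 <= a)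
  (loo_sum : \Rsum_(j : I) (if A m j then Rabs (x j - ths j) else 0) <=
     2 * p * (\Rsum_(j : I) Rabs (x j - ths j)) + 8 * ell * supnorm (fun j => x j - ths j)).

(** The cut of the singleton m is its degree, hence at least p (n - 1) / 4 >= a / 8. *)
Lemma degree_ge : a / 8 <= \Rsum_(j : I) (if A m j then 1 else 0).
Proof.
have := cut_ge [set m] setT_large.
set d := \Rsum_(j : I) (if A m j then 1 else 0).
have e (F : I -> I -> R) : (forall i j, F i j = F j i) -> F m m = 0 ->
    (forall i j, i != m -> j != m -> F i j = 0) ->
    \Rsum_(i : I | i \in [set: I]) \Rsum_(j : I | j \in [set: I]) F i j = 2 * \Rsum_(j : I) F m j.
  move=> symF F0 Fout.
  rewrite (eq_bigl xpredT) => [|i]; last by rewrite inE.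
  rewrite (eq_bigr (fun i => \Rsum_(j : I) F i j)) => [|i _]; last first.
    by apply: eq_bigl => j; rewrite inE.
  rewrite (bigD1 m) //=.
  have -> : \Rsum_(i : I | i != m) \Rsum_(j : I) F i j = \Rsum_(i : I | i != m) F m i.
    apply: eq_bigr => i im; rewrite (bigD1 m) //= big1 => [|j jm]; last exact: Fout.
    by rewrite Rplus_0_r.
  rewrite [\Rsum_(j : I) F m j](bigD1 m) //= F0.
  by set Z := \Rsum_(i : I | i != m) F m i; rewrite -/Z; ring.
have indicm : indic [set m] m = 1 by rewrite /indic inE eqxx.
have indico i : i != m -> indic [set m] i = 0 by rewrite /indic inE => /negPf ->.
rewrite !e.
- have -> : \Rsum_(j : I) Rabs (indic [set m] m - indic [set m] j) = INR n - 1.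
    rewrite (bigD1 m) //= indicm Rminus_diag Rabs_R0.
    rewrite (eq_bigr (fun=> 1)) => [|j jm]; last by rewrite indico // Rminus_0_r Rabs_R1.
    rewrite Rsum_const cardC1 card_ord; case: n n_gt1 => // k _; rewrite S_INR /=; ring.
  have -> : \Rsum_(j : I) (if A m j then Rabs (indic [set m] m - indic [set m] j) else 0) = d.
    apply: eq_bigr => j _; have [-> | jm] := eqVneq j m; first by rewrite irrA.
    by rewrite indicm (indico _ jm) Rminus_0_r Rabs_R1.
  by have := INRn_ge2; rewrite /a => h1 h2; nra.
- by move=> i j; rewrite symA Rabs_minus_sym.
- by rewrite irrA.
- by move=> i j im jm; rewrite !indico // Rminus_diag Rabs_R0; case: ifP.
- by move=> i j; rewrite Rabs_minus_sym.
- by rewrite Rminus_diag Rabs_R0.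
- by move=> i j im jm; rewrite !indico // Rminus_diag Rabs_R0.
Qed.

(** In row m, pass through [ths m - th j]. Changing only the score of m moves every term in the
    direction of th m - ths m by at least al D, without cancellation; changing the score of j costs
    at most |th j - ths j|. The penalty on the difference has the favourable sign. *)
Lemma row_bound : al * (\Rsum_(j : I) (if A m j then 1 else 0)) * D <=
  (10 + clam * T) * B + \Rsum_(j : I) (if A m j then Rabs (th j - ths j) else 0).
Proof.
have hb := Rabs_bounds (bias_le m); have he := th_ths_eq m; have hl := lam_gt0.
pose F j := if A m j then sigmoid (th m - th j) - sigmoid (ths m - th j) else 0.
pose H j := if A m j then sigmoid (ths m - th j) - sigmoid (ths m - ths j) else 0.
have eFH : \Rsum_(j : I) (if A m j then sigmoid (th m - th j) - sigmoid (ths m - ths j) else 0) =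
    \Rsum_(j : I) F j + \Rsum_(j : I) H j.
  by rewrite -Rsum_add; apply: eq_bigr => j _; rewrite /F /H; case: ifP => _; ring.
rewrite eFH in he.
have hH : Rabs (\Rsum_(j : I) H j) <= \Rsum_(j : I) (if A m j then Rabs (th j - ths j) else 0).
  apply: (Rle_trans _ _ _ (Rabs_bigsum_le xpredT H)); apply: Rsum_le => j _; rewrite /H; case: ifP => _.
    apply: Rle_trans (sigmoid_lip _ _) _; apply: Req_le.
    by rewrite Rabs_minus_sym; congr Rabs; ring.
  by rewrite Rabs_R0; lra.
have {}hH := Rabs_bounds hH.
have slope j := sigmoid_slope (th_diff_le m j) (ths_th_diff_le m j).
have e j : th m - th j - (ths m - th j) = th m - ths m by ring.
case: (Rle_lt_dec 0 (th m - ths m)) => hd.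
- have DE : th m - ths m = D by rewrite -D_m Rabs_right; lra.
  have hF : al * (\Rsum_(j : I) (if A m j then 1 else 0)) * D <= \Rsum_(j : I) F j.
    rewrite Rmult_assoc -Rsum_mulr -Rsum_mull; apply: Rsum_le => j _; rewrite /F; case: ifP => _; last lra.
    have := slope j; rewrite e DE -/al => hs.
    have [D0 | D0] : D = 0 \/ 0 < D by lra.
      by have : sigmoid (ths m - th j) <= sigmoid (th m - th j); [apply: sigmoid_le; lra | rewrite D0; lra].
    by apply: (Rmult_le_reg_r D) => //; lra.
  by nra.
- have DE : th m - ths m = - D by rewrite -D_m Rabs_left; lra.
  have hF : al * (\Rsum_(j : I) (if A m j then 1 else 0)) * D <= - \Rsum_(j : I) F j.
    rewrite Rmult_assoc -Rsum_opp -Rsum_mulr -Rsum_mull; apply: Rsum_le => j _; rewrite /F; case: ifP => _; last lra.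
    have := slope j; rewrite e DE -/al => hs.
    by apply: (Rmult_le_reg_r D); lra.
  by nra.
Qed.

Lemma loo_const_gt0 : 0 < C3.
Proof.
have h : 0 < 76800 / al by apply: Rdiv_lt_0_compat; [lra | exact: al_gt0].
by rewrite /C3 /loo_const -/M -/al; lra.
Qed.

Lemma loo_error_ge0 : 0 <= loo_error.
Proof.
have h := loo_const_gt0; have D0 := D_ge0.
apply: Rmult_le_pos; first exact: Rlt_le.
apply: Rplus_le_le_0_compat; last exact/Rlt_le/rho_gt0.
by apply: Rmult_le_pos => //; apply/Rlt_le/Rinv_0_lt_compat/sqrt_lt_R0/a_gt0.
Qed.

Lemma loo_le j : j != m -> Rabs (th j - x j) <= loo_error.
Proof.
move=> jm; have he := loo_error_ge0.
apply: Rsqr_incr_0_var => //; rewrite -Rsqr_abs !Rsqr_pow2.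
apply: Rle_trans loo_l2; apply: (@Rsum_term _ (fun i => i \in [set~ m]) (fun i => (th i - x i) ^ 2)).
  by move=> i _; exact: pow2_ge_0.
by rewrite !inE.
Qed.

Lemma C2_ge0 : 0 <= C2.
Proof.
have h1 := al_gt0; have h2 := T_ge0; have h3 := clam_gt0.
have h4 := Rmult_le_pos _ _ (Rlt_le _ _ h3) h2.
by apply: Rlt_le; apply: Rdiv_lt_0_compat => //; lra.
Qed.

Lemma abs_sum_le (P : pred I) (F : I -> R) c k : 0 <= c -> 0 <= k ->
  INR #|P| <= c ^ 2 -> \Rsum_(i : I | P i) F i ^ 2 <= k ^ 2 ->
  \Rsum_(i : I | P i) Rabs (F i) <= c * k.
Proof.
move=> c_ge0 k_ge0 hP hF; apply: Rsqr_incr_0_var; last exact: Rmult_le_pos.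
rewrite !Rsqr_pow2; apply: (Rle_trans _ _ _ (Rsum_sqr_le P _)).
rewrite Rpow_mult_distr; apply: Rmult_le_compat => //; first exact: pos_INR.
  by apply: Rsum_ge0 => i _; exact: pow2_ge_0.
apply: Rle_trans hF; apply: Req_le; apply: eq_bigr => i _; exact: pow2_abs.
Qed.

(** Cauchy-Schwarz over the at most 3 a <= (2 sqrt a)^2 neighbours of m. *)
Lemma neighbour_drift : \Rsum_(j : I) (if A m j then Rabs (th j - x j) else 0)
  <= 2 * (sqrt a * loo_error).
Proof.
have ha := a_gt0; have he := loo_error_ge0.
have hq : sqrt a ^ 2 = a by rewrite pow2_sqrt; lra.
have hq0 := sqrt_pos a.
rewrite -Rsum_mkcond -Rmult_assoc; apply: abs_sum_le => //; first lra.
  rewrite Rpow_mult_distr hq; have := degree_le m; rewrite -Rsum_mkcond Rsum_const Rmult_1_r.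
  by move=> h; apply: Rle_trans h _; lra.
apply: Rle_trans loo_l2; rewrite [X in X <= _]Rsum_mkcond [X in _ <= X]Rsum_mkcond; apply: Rsum_le => j _; rewrite !inE.
by case: eqVneq => [-> | _] /=; [rewrite irrA; lra | case: ifP => _; have := pow2_ge_0 (th j - x j); lra].
Qed.

(** Triangle inequality through theta, then Cauchy-Schwarz over all items; p sqrt n <= sqrt a
    because p <= 1. *)
Lemma loo_abs_sum : p * (\Rsum_(j : I) Rabs (x j - ths j)) <= C2 * B + sqrt a * loo_error.
Proof.
have ha := a_gt0; have he := loo_error_ge0; have n2 := INRn_ge2; have hC2 := C2_ge0.
have hrho := rho_gt0.
have h1 : \Rsum_(j : I) Rabs (th j - ths j) <= INR n * (C2 * rho).
  apply: Rle_trans (_ : sqrt (INR n) * (sqrt (INR n) * (C2 * rho)) <= _); last first.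
    by rewrite -Rmult_assoc sqrt_sqrt; lra.
  apply: (@abs_sum_le xpredT (fun j => th j - ths j)).
  - exact: sqrt_pos.
  - by apply: Rmult_le_pos; [exact: sqrt_pos | apply: Rmult_le_pos; lra].
  - by rewrite pow2_sqrt ?cardT ?size_enum_ord; lra.
  - by rewrite Rpow_mult_distr pow2_sqrt; [exact: l2_error | lra].
have h2 : \Rsum_(j : I | j != m) Rabs (th j - x j) <= sqrt (INR n) * loo_error.
  apply: (@abs_sum_le (fun j => j != m) (fun j => th j - x j)) => //; first exact: sqrt_pos.
    rewrite pow2_sqrt; last lra.
    by apply: le_INR; apply/leP; apply: leq_trans (max_card _) _; rewrite card_ord.
  apply: Rle_trans loo_l2; apply: Req_le; apply: eq_bigl => j; by rewrite !inE.
have h3 : \Rsum_(j : I) Rabs (x j - ths j) <= INR n * (C2 * rho) + sqrt (INR n) * loo_error.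
  apply: (Rle_trans _ _ _ _ (Rplus_le_compat _ _ _ _ h1 h2)).
  rewrite [\Rsum_(j : I | j != m) _]Rsum_mkcond -Rsum_add; apply: Rsum_le => j _.
  have hj := Rabs_pos (th j - ths j).
  case: eqVneq => [-> | _] /=; first by rewrite x_m Rminus_diag Rabs_R0; have := Rabs_pos (th m - ths m); lra.
  have -> : x j - ths j = (th j - ths j) + - (th j - x j) by ring.
  by rewrite -(Rabs_Ropp (th j - x j)); exact: Rabs_triang.
have h4 : p * sqrt (INR n) <= sqrt a.
  apply: Rsqr_incr_0_var; last exact: sqrt_pos.
  rewrite Rsqr_mult !Rsqr_sqrt; try lra.
  have pp : p * p <= p by have := p_gt0; have := p_le1; nra.
  by rewrite /Rsqr /a Rmult_comm; apply: Rmult_le_compat_l; lra.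
have := Rmult_le_compat_l _ _ _ (Rlt_le _ _ p_gt0) h3.
have -> : p * (INR n * (C2 * rho) + sqrt (INR n) * loo_error) =
  a * rho * C2 + p * sqrt (INR n) * loo_error by rewrite /a; ring.
have -> : a * rho = B by rewrite /rho; field; lra.
by have := Rmult_le_compat_r _ _ _ he h4; lra.
Qed.

Lemma loo_sup : supnorm (fun j => x j - ths j) <= D + loo_error.
Proof.
have he := loo_error_ge0; have D0 := D_ge0.
apply: supnorm_le => [|j]; first lra.
have [-> | jm] := eqVneq j m; first by rewrite x_m Rminus_diag Rabs_R0; lra.
have -> : x j - ths j = (th j - ths j) + - (th j - x j) by ring.
apply: Rle_trans (Rabs_triang _ _) _; rewrite Rabs_Ropp.
by have := D_max j; have := loo_le jm; lra.
Qed.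

Definition core_const (clam T : R) : R :=
  16 * (11 + clam * T + 2 * l2_const clam T + 4 * loo_const clam T)
    / sig_slope (slope_range clam T).

(** The degree bound makes the left side of [row_bound] at least al a D / 8. On the right, D enters
    with coefficient 4 C3 through the l2 drift and with al a / 32 through the supremum of x -
    theta*. The choice of c0 makes the first at most al a / 32 as well, so al a D / 16 survives. *)
Lemma sup_error_le : D <= core_const clam T * (B / a).
Proof.
have ha := a_gt0; have he := loo_error_ge0; have D0 := D_ge0; have hal := al_gt0.
have hC2 := C2_ge0; have hC3 := loo_const_gt0; have hrho := rho_gt0.
have aB : a * rho = B by rewrite /rho; field; lra.
have q1 : 1 <= sqrt a by rewrite -sqrt_1; apply: sqrt_le_1; lra.
have qq : sqrt a * sqrt a = a by rewrite sqrt_sqrt; lra.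
set q := sqrt a in q1 qq.
have qe : q * loo_error <= C3 * (D + B).
  have -> : q * loo_error = C3 * (D + q * rho) by rewrite /loo_error -/q; field; lra.
  have qr : 0 <= q * rho by apply: Rmult_le_pos; lra.
  have e : q * (q * rho) = B by rewrite -[RHS]aB -[a in RHS]qq; ring.
  have h := Rmult_le_compat_r _ _ _ qr q1; rewrite e in h.
  by apply: Rmult_le_compat_l; lra.
have ee : loo_error <= C3 * (D + rho).
  have hDq : D / q <= D.
    apply: (Rmult_le_reg_r q); first lra.
    by rewrite /Rdiv Rmult_assoc Rinv_l; [nra | lra].
  by rewrite /loo_error -/q; apply: Rmult_le_compat_l; lra.
have hS : \Rsum_(j : I) (if A m j then Rabs (th j - ths j) else 0) <=
    \Rsum_(j : I) (if A m j then Rabs (th j - x j) else 0) +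
    \Rsum_(j : I) (if A m j then Rabs (x j - ths j) else 0).
  rewrite -Rsum_add; apply: Rsum_le => j _; case: ifP => _; last lra.
  have -> : th j - ths j = (th j - x j) + (x j - ths j) by ring.
  exact: Rabs_triang.
have h8 : 8 * ell * supnorm (fun j => x j - ths j) <= al / 32 * (a * D + B).
  apply: Rle_trans (_ : 8 * (a / c0) * ((1 + C3) * (D + rho)) <= _).
    apply: Rmult_le_compat; try lra.
    - exact: supnorm_ge0.
    - by apply: Rle_trans loo_sup _; lra.
  have h1 : (1 + C3) / c0 <= al / 256.
    apply: (Rmult_le_reg_r (256 * c0 / al)); first by apply: Rdiv_lt_0_compat; lra.
    have -> : (1 + C3) / c0 * (256 * c0 / al) = 256 * (1 + C3) / al by field; lra.
    by have -> : al / 256 * (256 * c0 / al) = c0 by field; lra.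
  have -> : 8 * (a / c0) * ((1 + C3) * (D + rho)) = (1 + C3) / c0 * (8 * (a * D + a * rho)).
    by field; lra.
  rewrite aB; have haD := Rmult_le_pos _ _ (Rlt_le _ _ ha) D0.
  have hB := B_gt0.
  by have := Rmult_le_compat_r (8 * (a * D + B)) _ _ ltac:(lra) h1; lra.
have hdeg : al * (a / 8) * D <= al * (\Rsum_(j : I) (if A m j then 1 else 0)) * D.
  apply: Rmult_le_compat_r => //; apply: Rmult_le_compat_l; [lra | exact: degree_ge].
have hC3a : 4 * C3 <= al / 32 * a.
  have h1 : 256 * (1 + C3) / al <= 2 * a by have := c0_ge; have := a_ge; lra.
  have := Rmult_le_compat_l _ _ _ (Rlt_le _ _ hal) h1.
  have -> : al * (256 * (1 + C3) / al) = 256 * (1 + C3) by field; lra.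
  by lra.
have := Rmult_le_compat_r _ _ _ D0 hC3a => hCD.
have hnd := neighbour_drift; have hla := loo_abs_sum; rewrite -/q in hnd hla.
have hrow := row_bound; have hls := loo_sum.
have hal1 := al_le1; have hB := B_gt0.
have halB : al / 32 * B <= B by nra.
have main : al / 16 * a * D <= (11 + clam * T + 2 * C2 + 4 * C3) * B by lra.
apply: (Rmult_le_reg_l (al / 16 * a)); first by nra.
apply: Rle_trans main _; apply: Req_le.
by rewrite /core_const -/C2 -/C3 -/M -/al; field; lra.
Qed.

End LeaveOneOut.
End Deterministic.

(** * Concentration events *)

Lemma card_setD_ge (T : finType) (S W : {set T}) n : (1 < n)%N -> S \subset W ->
  (2 * #|S| <= #|W|)%N -> (n <= #|W|.+1)%N -> INR n / 4 <= INR #|W :\: S|.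
Proof.
move=> n1 SW SW2 Wn.
have e : INR #|W| = INR #|S| + INR #|W :\: S|.
  by rewrite -plus_INR plusE -(cardsID S W) (setIidPr SW).
have := le_INR _ _ (elimT leP SW2); rewrite mult_INR.
have := le_INR _ _ (elimT leP Wn); rewrite S_INR.
by have := le_INR _ _ (elimT leP n1); rewrite /=; lra.
Qed.

Section Concentration.
Variables (n L : nat) (w : 'I_n -> R) (p ell r B : R).
Notation I := ('I_n).
Notation outc := (outcome n L).
Implicit Types (o : outc) (i j m : I) (S W : {set I}).
Let a : R := INR n * p.
Hypotheses (n_gt1 : (1 < n)%N) (L_gt0 : (0 < L)%N) (w_gt0 : forall i, 0 < w i)
  (p01 : 0 <= p <= 1) (ell_gt0 : 0 < ell) (r_gt0 : 0 < r) (B_gt0 : 0 < B)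
  (r_sqr : INR L * r ^ 2 = ell) (B_sqr : B ^ 2 = a * r ^ 2)
  (a_ge : 128 * ell <= a) (ell_def : exp ell = INR n).

(** This and the following [bad_] quantities are exponential moments normalised to be below 1
    exactly when the intended strict bound holds; a boolean selects the sign of a two-sided
    bound. *)
Definition bad_degree o m : R :=
  exp (\Rsum_(j : I) (if adj o m j then 1 else 0) - 2 * p * \Rsum_(j : I) 1) * exp (- (8 * ell)).

Definition noise_sum o m : R :=
  \Rsum_(j : I) (if adj o m j then win_freq o m j - win_prob w m j else 0).

Definition bad_noise o m (b : bool) : R :=
  exp ((if b then 1 else -1) * (ell / B) * noise_sum o m) * exp (- (10 * ell)).

Definition bad_edge o i j (b : bool) : R :=
  exp ((if b then 1 else -1) * (ell / r) *
       (if adj o i j then win_freq o i j - win_prob w i j else 0)) * exp (- (9 * ell)).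

Definition cut_size o S W : R :=
  \Rsum_(i : I | i \in S) \Rsum_(j : I | j \in W :\: S) (if adj o i j then 1 else 0).

Definition bad_cut o S W : R :=
  exp (- cut_size o S W) * exp (p / 4 * (INR #|S| * INR #|W :\: S|)).

Lemma Ex_bad_degree m : Ex w p (fun o => bad_degree o m) <= exp (- (8 * ell)).
Proof.
rewrite Ex_mulr -[X in _ <= X]Rmult_1_l; apply: Rmult_le_compat_r; first exact/Rlt_le/exp_pos.
by apply: (@Ex_exp_star _ _ _ _ w_gt0 p01 m (fun _ _ => 1)) => // o j; lra.
Qed.

Lemma sign_sqr (b : bool) (y : R) : ((if b then 1 else -1) * y) ^ 2 = y ^ 2.
Proof. by case: b; ring. Qed.

Lemma Ex_bad_noise m b : Ex w p (fun o => bad_noise o m b) <= exp (- (8 * ell)).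
Proof.
have L0 : 0 < INR L by apply: lt_0_INR; apply/ltP.
have a0 : 0 < a by lra.
have n0 : 0 < INR n by apply: lt_0_INR; apply/ltP; exact: ltn_trans n_gt1.
set s := (if b then 1 else -1) * (ell / B).
(* The tilt ell / B gives one edge the variance term ell / a, so the roughly a edges at m cost a
   multiple of ell. *)
have sL : s ^ 2 / INR L = ell / a.
  rewrite /s sign_sqr.
  have -> : (ell / B) ^ 2 = ell ^ 2 / B ^ 2 by field; lra.
  by rewrite B_sqr -r_sqr; field; split; lra.
pose c i j := if i == m then s else 0.
(* As ell / a <= 1, p (exp (ell / a) - 1) <= 2 p ell / a = 2 ell / n. Over all partners this is at
   most 2 ell, and 10 - 2 = 8. *)
pose v i j := if (i == m) && (j != m) then 2 * ell / INR n else 0.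
have v0 i : v i i = 0 by rewrite /v; case: eqP.
have small : 1 - p + p * exp (ell / a) <= exp (2 * ell / INR n).
  have ea : 0 <= ell / a <= 1.
    split; first by apply: Rlt_le; apply: Rdiv_lt_0_compat.
    by apply: (Rmult_le_reg_r a) => //; rewrite /Rdiv Rmult_assoc Rinv_l; lra.
  have := @exp_le_quadratic (ell / a) ltac:(lra).
  have := exp_ge1D (2 * ell / INR n).
  have -> : 2 * ell / INR n = p * (2 * (ell / a)).
    have p0 : p <> 0 by move=> p0; move: a0; rewrite /a p0; lra.
    by rewrite /a; field; split; lra.
  have h2 : (ell / a) ^ 2 <= ell / a by nra.
  by move=> h3 h4; have := Rmult_le_compat_l p _ _ (proj1 p01) (Rle_trans _ _ _ h4 (Rplus_le_compat_l _ _ _ h2)); lra.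
have hv i j : i != j -> 1 - p + p * exp ((c i j - c j i) ^ 2 / INR L) <= exp (v i j + v j i).
  rewrite /c /v; case: (i == m); case: (j == m) => _; cbv [negb andb].
  - have -> : (s - s) ^ 2 / INR L = 0 by field; lra.
    by rewrite Rplus_0_r exp_0; lra.
  - by rewrite Rminus_0_r sL Rplus_0_r.
  - have -> : (0 - s) ^ 2 = s ^ 2 by ring.
    by rewrite sL Rplus_0_l.
  - have -> : (0 - 0) ^ 2 / INR L = 0 by field; lra.
    by rewrite Rplus_0_r exp_0; lra.
have h := Ex_exp_noise_le w_gt0 p01 L_gt0 v0 hv.
have hv2 : \Rsum_(i : I) \Rsum_(j : I) v i j <= 2 * ell.
  rewrite (bigD1 m) //= [X in _ + X]big1 => [|i im].
    have -> : 2 * ell = \Rsum_(j : I) (2 * ell / INR n).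
      by rewrite Rsum_constT card_ord; field; lra.
    rewrite Rplus_0_r; apply: Rsum_le => j _; rewrite /v eqxx /=; case: ifP => _; first lra.
    by apply: Rlt_le; apply: Rdiv_lt_0_compat; lra.
  by apply: big1 => j _; rewrite /v (negPf im).
have -> : exp (- (8 * ell)) = exp (2 * ell) * exp (- (10 * ell)).
  by rewrite -exp_plus; congr exp; ring.
rewrite Ex_mulr; apply: Rmult_le_compat_r; first exact/Rlt_le/exp_pos.
apply: Rle_trans (exp_monotone hv2); apply: Rle_trans h; apply: Req_le.
apply: eq_bigr => o _; congr (_ * exp _).
rewrite [RHS](bigD1 m) //= [X in _ = _ + X]big1 => [|i im].
  rewrite Rplus_0_r /noise_sum -Rsum_mull; apply: eq_bigr => j _.
  by rewrite /c eqxx; case: (adj o m j); rewrite /s; ring.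
by apply: big1 => j _; rewrite /c (negPf im); case: ifP => _; ring.
Qed.

(** Only one edge is involved, so the tilt ell / r costs at most exp ell whatever p is, and 9 - 1 =
    8. *)
Lemma Ex_bad_edge i0 j0 b : Ex w p (fun o => bad_edge o i0 j0 b) <= exp (- (8 * ell)).
Proof.
have L0 : 0 < INR L by apply: lt_0_INR; apply/ltP.
set s := (if b then 1 else -1) * (ell / r).
have sL : s ^ 2 / INR L = ell.
  rewrite /s sign_sqr.
  have -> : (ell / r) ^ 2 = ell ^ 2 / r ^ 2 by field; lra.
  by rewrite -r_sqr; field; split; lra.
pose c i j := if (i == i0) && (j == j0) then s else 0.
pose v i j := if [&& i == i0, j == j0 & i != j] then ell else 0.
have v0 i : v i i = 0 by rewrite /v eqxx !andbF.
have e1 : 1 <= exp ell by have := exp_ge1D ell; lra.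
have hv i j : i != j -> 1 - p + p * exp ((c i j - c j i) ^ 2 / INR L) <= exp (v i j + v j i).
  move=> ij; rewrite /c /v (eq_sym j i) ij !andbT.
  have h1 : ((i == i0) && (j == j0)) && ((j == i0) && (i == j0)) = false.
    by apply/negP => /andP[/andP[/eqP ei _] /andP[/eqP ej _]]; rewrite ei ej eqxx in ij.
  move: h1; move: ((i == i0) && _) ((j == i0) && _) => [] [] // _; cbv [negb andb].
  - by rewrite Rminus_0_r sL Rplus_0_r; have := p01; nra.
  - have -> : (0 - s) ^ 2 = s ^ 2 by ring.
    by rewrite sL Rplus_0_l; have := p01; nra.
  - have -> : (0 - 0) ^ 2 / INR L = 0 by field; lra.
    by rewrite Rplus_0_r exp_0; lra.
have h := Ex_exp_noise_le w_gt0 p01 L_gt0 v0 hv.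
have hv2 : \Rsum_(i : I) \Rsum_(j : I) v i j <= ell.
  rewrite (bigD1 i0) //= [X in _ + X]big1 => [|i im]; last first.
    by apply: big1 => j _; rewrite /v (negPf im).
  rewrite (bigD1 j0) //= [X in _ + X + _]big1 => [|j jm]; last first.
    by rewrite /v (negPf jm) andbF.
  by rewrite /v; case: ifP => _; lra.
have -> : exp (- (8 * ell)) = exp ell * exp (- (9 * ell)).
  by rewrite -exp_plus; congr exp; ring.
rewrite Ex_mulr; apply: Rmult_le_compat_r; first exact/Rlt_le/exp_pos.
apply: Rle_trans (exp_monotone hv2); apply: Rle_trans h; apply: Req_le.
apply: eq_bigr => o _; congr (_ * exp _).
rewrite [RHS](bigD1 i0) //= [X in _ = _ + X]big1 => [|i im]; last first.
  by apply: big1 => j _; rewrite /c (negPf im) /=; case: ifP => _; lra.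
rewrite [X in _ = X + _](bigD1 j0) //= [X in _ = _ + X + _]big1 => [|j jm]; last first.
  by rewrite /c (negPf jm) andbF /=; case: ifP => _; lra.
by rewrite /c !eqxx /=; case: (adj o i0 j0); rewrite /s; lra.
Qed.

Lemma double_sum_block (c : R) S W : \Rsum_(i : I) \Rsum_(j : I)
  (if (i \in S) && (j \in W) then c else 0) = c * (INR #|S| * INR #|W|).
Proof.
transitivity (\Rsum_(i : I | i \in S) \Rsum_(j : I | j \in W) c).
  rewrite [RHS]Rsum_mkcond; apply: eq_bigr => i _; case: (i \in S) => /=.
    by rewrite [RHS]Rsum_mkcond.
  by rewrite big1.
by rewrite !Rsum_const_in -[LHS]Rmult_assoc [RHS]Rmult_comm.
Qed.

(** As exp(-1) <= 1/2, each pair across the cut contributes a factor at most exp(-p / 2). After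
    compensating p / 4, the remaining p / 4 per pair suffices, since |W \ S| >= n / 4 and a >= 128
    ell give p |W \ S| / 4 >= 8 ell for each element of S. *)
Lemma Ex_bad_cut S W : S \subset W -> (2 * #|S| <= #|W|)%N -> (n <= #|W|.+1)%N ->
  Ex w p (fun o => bad_cut o S W) <= exp (- (8 * ell)) ^ #|S|.
Proof.
move=> SW SW2 Wn.
pose c i j : R := if (i \in S) && (j \in W :\: S) then -1 else 0.
pose v i j : R := if (i \in S) && (j \in W :\: S) then - (p / 2) else 0.
have disj i : (i \in S) && (i \in W :\: S) = false by rewrite inE; case: (i \in S).
have e1 : exp (-1) <= / 2.
  have -> : -1 = Ropp 1 by lra.
  by rewrite exp_Ropp; apply: Rinv_le_contravar; have := exp_ge1D 1; lra.
have hp := exp_ge1D (- (p / 2)).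
have hv i j : i != j -> 1 - p + p * exp (c i j + c j i) <= exp (v i j + v j i).
  move=> _; have h1 : ((i \in S) && (j \in W :\: S)) && ((j \in S) && (i \in W :\: S)) = false.
    by rewrite !inE; case: (i \in S); case: (j \in S); rewrite ?andbF.
  rewrite /c /v; move: h1; move: ((i \in S) && _) ((j \in S) && _) => [] [] // _;
    rewrite ?Rplus_0_r ?Rplus_0_l ?exp_0; by have := p01; nra.
have v0 i : v i i = 0 by rewrite /v disj.
have h := Ex_exp_adj_le L w_gt0 p01 v0 hv.
rewrite double_sum_block in h.
rewrite Ex_mulr; apply: Rle_trans (_ : exp (- (p / 2) * (INR #|S| * INR #|W :\: S|)) *
    exp (p / 4 * (INR #|S| * INR #|W :\: S|)) <= _).
  apply: Rmult_le_compat_r; first exact/Rlt_le/exp_pos.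
  apply: Rle_trans h; apply: Req_le; apply: eq_bigr => o _; congr (_ * exp _).
  rewrite -Rsum_opp Rsum_mkcond; apply: eq_bigr => i _; rewrite /c; case: (i \in S) => /=.
    rewrite -Rsum_opp Rsum_mkcond; apply: eq_bigr => j _.
    by case: (j \in _); case: ifP => _; lra.
  by rewrite big1 // => j _; case: ifP.
rewrite -exp_plus.
have -> : exp (- (8 * ell)) ^ #|S| = exp (- (8 * ell) * INR #|S|).
  elim: #|S| => [|k IH]; first by rewrite Rmult_0_r exp_0.
  by rewrite S_INR Rmult_plus_distr_l exp_plus Rmult_1_r -IH /= Rmult_comm.
apply: exp_monotone.
have D2 : INR n / 4 <= INR #|W :\: S| by apply: card_setD_ge.
have S0 := pos_INR #|S|.
have h1 : p * (INR n / 4) <= p * INR #|W :\: S| by apply: Rmult_le_compat_l; lra.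
have h2 : 32 * ell <= p * INR #|W :\: S| by have := a_ge; rewrite /a; lra.
have := Rmult_le_compat_r _ _ _ S0 h2.
by move: (INR #|S|) (INR #|_|) => s d; lra.
Qed.

(** By the binomial theorem the sum over all sets is (1 + q)^n <= exp(n q) <= 1 + n q + (n q)^2; the
    empty set accounts for the 1. *)
Lemma sum_sets_pow (q : R) : 0 <= q -> INR n * q <= 1 ->
  \Rsum_(S : {set I} | S != set0) q ^ #|S| <= 2 * (INR n * q).
Proof.
move=> q0 nq.
have h : \Rsum_(S : {set I}) q ^ #|S| = (1 + q) ^ n.
  have -> : (1 + q) ^ n = \Rprod_(i : I) (q + 1).
    by rewrite big_const card_ord Rplus_comm; elim: (n) => //= k ->.
  rewrite bigA_distr; apply: eq_big => [S|S _]; first by rewrite inE.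
  by rewrite -big_mkcond /= big_const; elim: #|S| => //= k ->.
rewrite (bigD1 set0) //= cards0 in h.
have h2 : (1 + q) ^ n <= exp (INR n * q).
  elim: (n) => [|k IH]; first by rewrite Rmult_0_l exp_0; right.
  rewrite S_INR Rmult_plus_distr_r Rmult_1_l exp_plus [X in X <= _]Rmult_comm.
  by apply: Rmult_le_compat; [apply: pow_le; lra | lra | | exact: exp_ge1D].
have := @exp_le_quadratic _ nq.
have nq0 : 0 <= INR n * q by apply: Rmult_le_pos => //; exact: pos_INR.
by rewrite /= in h; set T := \Rsum_(_ : _ | _) _; rewrite -/T in h; nra.
Qed.

(** Erasing item m is resampling it from a constant outcome, so a function of [mask m o] is
    automatically unaffected by the coordinates of m. *)
Definition mask m o : outc :=
  resample m o ([ffun=> [ffun=> false]], [ffun=> [ffun=> [ffun=> false]]]).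

Lemma mask_resample m o o' : mask m (resample m o o') = mask m o.
Proof.
rewrite /mask /resample /=; congr (_, _); apply/ffunP => i; rewrite !ffunE;
  by apply/ffunP => j; rewrite !ffunE; case: (_ || _).
Qed.

Lemma adj_mask m o i j : adj (mask m o) i j = [&& adj o i j, i != m & j != m].
Proof.
rewrite /adj /= !ffunE; case: ltngtP => _ //;
  by case: (i == m); case: (j == m); rewrite ?andbF ?andbT.
Qed.

Lemma win_freq_mask m o i j : i != m -> j != m -> win_freq (mask m o) i j = win_freq o i j.
Proof.
move=> im jm; rewrite /win_freq /ybar.
have e k l : k != m -> l != m -> (mask m o).2 k l = o.2 k l.
  by move=> km lm; rewrite /= !ffunE (negPf km) (negPf lm).
by rewrite !e.
Qed.

Variables (clam T : R) (ths : I -> R).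
Let lam : R := clam * B.
Hypotheses (clam_gt0 : 0 < clam) (ths_le : forall i, Rabs (ths i) <= T)
  (ths_sum : \Rsum_(i : I) ths i = 0)
  (ths_win_prob : forall i j, sigmoid (ths i - ths j) = win_prob w i j).

Definition small_noise o : Prop :=
  (forall i, Rabs (noise (adj o) (win_freq o) ths i) <= 10 * B) /\
  (forall i j, adj o i j -> Rabs (win_freq o i j - sigmoid (ths i - ths j)) <= 9 * r).

Lemma n_gt0 : 0 < INR n.
Proof. by apply: lt_0_INR; apply/ltP; exact: ltn_trans n_gt1. Qed.

Lemma r_le_noise_scale : r <= B.
Proof.
have e1 : 1 <= a.
  have := a_ge; have := exp_ge1D (- ell); rewrite exp_Ropp ell_def.
  have := le_INR _ _ (elimT leP n_gt1); rewrite /= => h1 h2.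
  have : / INR n <= / 2 by apply: Rinv_le_contravar; lra.
  by lra.
by apply: Rsqr_incr_0_var; rewrite ?Rsqr_pow2 ?B_sqr; have := pow2_ge_0 r; nra.
Qed.

(** Row i loses at most one edge, so the bound grows from 10 B to 10 B + 9 r, and r <= B. *)
Lemma mask_noise m o i : small_noise o ->
  Rabs (noise (adj (mask m o)) (win_freq (mask m o)) ths i) <= 19 * B.
Proof.
move=> [h1 h2]; have hr := r_le_noise_scale; have hB := B_gt0; rewrite /noise.
have [-> | im] := eqVneq i m.
  rewrite big1 ?Rabs_R0 => [|j _]; first lra.
  by rewrite adj_mask eqxx /= andbF.
have -> : \Rsum_(j : I) (if adj (mask m o) i j
     then win_freq (mask m o) i j - sigmoid (ths i - ths j) else 0) =
   noise (adj o) (win_freq o) ths i -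
   (if adj o i m then win_freq o i m - sigmoid (ths i - ths m) else 0).
  rewrite /noise (bigD1 m) //= [X in _ = X - _](bigD1 m) //= adj_mask eqxx !andbF.
  set P := (X in _ + X = _); set Q := (X in _ = _ + X - _).
  have -> : P = Q; last by lra.
  apply: eq_bigr => j jm; rewrite adj_mask im jm !andbT; case: ifP => // _.
  by rewrite win_freq_mask.
have h3 : Rabs (if adj o i m then win_freq o i m - sigmoid (ths i - ths m) else 0) <= 9 * r.
  by case: ifP => [/h2 // | _]; rewrite Rabs_R0; have := r_gt0; lra.
have := Rabs_bounds (h1 i); have := Rabs_bounds h3 => g1 g2.
by apply: Rabs_le; lra.
Qed.

(* x m o is an approximate minimiser for the data without item m, so that no compactness argument
   is needed; it is translated to have the same sum as ths over the other items. *)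
Lemma loo_exists : exists x : I -> outc -> I -> R, forall m o,
  [/\ forall o', x m (resample m o o') = x m o,
      x m o m = ths m,
      \Rsum_(i : I) x m o i = 0,
      small_noise o ->
        forall i j, i != m -> j != m -> Rabs (x m o i - x m o j) <= slope_range clam T
    & exists s, forall i, i != m ->
        Rabs (\Rsum_(j : I | j != m) (if adj o i j
                then sigmoid (x m o i - x m o j) - win_freq o i j else 0)
              + lam * x m o i - s) <= B / INR n].
Proof.
have hn := n_gt0; have hn2 := le_INR _ _ (elimT leP n_gt1); rewrite /= in hn2.
have lam0 : 0 < lam by apply: Rmult_lt_0_compat.
have eta0 : 0 < B / INR n by apply: Rdiv_lt_0_compat.
have etaB : B / INR n <= B.
  apply: (Rmult_le_reg_r (INR n)) => //; rewrite /Rdiv Rmult_assoc Rinv_l; last lra.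
  by have := B_gt0; nra.
(* The choice is a function of the outcome alone; evaluated at [mask m o] it cannot see item m. *)
pose X o := epsilon (inhabits (fun=> 0))
  (fun x : I -> R => forall k, Rabs (score o x k + lam * x k) <= B / INR n).
have hX o k : Rabs (score o (X o) k + lam * X o k) <= B / INR n.
  exact: (epsilon_spec _ _ (approx_stationary o L_gt0 (Rlt_le _ _ lam0) eta0)).
(* The shift solves ths m + sum over j != m of (X j + sh) = 0. It leaves differences unchanged and
   adds only lam * sh to each equation, which s absorbs. *)
pose sh m o := - (ths m + \Rsum_(j : I | j != m) X (mask m o) j) / INR n.-1.
have n10 : INR n.-1 <> 0 by apply: not_0_INR; case: (n) n_gt1 => [|[|k]].
exists (fun m o i => if i == m then ths m else X (mask m o) i + sh m o) => m o.
split.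
- by move=> o'; rewrite /sh !mask_resample.
- by rewrite eqxx.
- rewrite (bigD1 m) //= eqxx.
  rewrite (eq_bigr (fun i => X (mask m o) i + sh m o)) => [|i /negPf -> //].
  rewrite Rsum_add Rsum_const cardC1 card_ord /sh.
  set Q := \Rsum_(j : I | j != m) X (mask m o) j; rewrite -/Q; field; exact: n10.
- move=> ho i j im jm; rewrite (negPf im) (negPf jm).
  have hb k := @max_principle n (adj (mask m o)) (win_freq (mask m o)) ths (X (mask m o)) lam
    (19 * B) (B / INR n) T lam0 (hX (mask m o)) (fun i => mask_noise m i ho) ths_le k.
  have hc : (19 * B + B / INR n) / lam <= 20 / clam.
    have -> : 20 / clam = (20 * B) / lam by rewrite /lam; have := B_gt0; have := clam_gt0; move=> h1 h2; field; lra.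
    by apply: Rmult_le_compat_r; [exact/Rlt_le/Rinv_0_lt_compat | lra].
  have := Rabs_bounds (hb i); have := Rabs_bounds (hb j) => h1 h2.
  by apply: Rabs_le; rewrite /slope_range; lra.
- exists (lam * sh m o) => i im; rewrite (negPf im).
  have := hX (mask m o) i; congr (Rabs _ <= _).
  have -> : \Rsum_(j : I | j != m) (if adj o i j then sigmoid (X (mask m o) i + sh m o -
      (if j == m then ths m else X (mask m o) j + sh m o)) - win_freq o i j else 0) =
    score (mask m o) (X (mask m o)) i; last by ring.
  rewrite /score [RHS](bigD1 m) //= adj_mask eqxx !andbF Rplus_0_l; apply: eq_bigr => j jm.
  rewrite (negPf jm) adj_mask im jm !andbT win_freq_mask //.
  by have -> : X (mask m o) i + sh m o - (X (mask m o) j + sh m o) =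
    X (mask m o) i - X (mask m o) j by ring.
Qed.

(** Enumerates the n + 1 vertex sets missing at most one item, so that the union over them has only
    a factor n + 1. *)
Definition cut_domain (k : option I) : {set I} :=
  if k is Some m then [set~ m] else [set: I].

Lemma cut_domainP W : (n <= #|W|.+1)%N -> exists k, W = cut_domain k.
Proof.
move=> Wn; have [W0 | /set0Pn[m mW]] := eqVneq (~: W) set0.
  by exists None; rewrite -(setCK W) W0 setC0.
exists (Some m); apply/eqP; rewrite eqEcard; apply/andP; split.
  by apply/subsetP => i iW; rewrite !inE; apply: contraTneq iW => ->; rewrite -in_setC.
by rewrite cardsC1 card_ord -ltnS; apply: leq_trans Wn; rewrite prednK // (ltn_trans _ n_gt1).
Qed.

Lemma cut_domain_large k : (n <= #|cut_domain k|.+1)%N.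
Proof. by case: k => [m|] /=; rewrite ?cardsC1 ?cardsT card_ord ?leqSpred. Qed.

Definition is_cut k S : bool :=
  [&& S != set0, S \subset cut_domain k & (2 * #|S| <= #|cut_domain k|)%N].

Variable x : I -> outc -> I -> R.
Hypothesis x_resample : forall m o o', x m (resample m o o') = x m o.

(** Dividing by the sup norm puts the weights in [0, 1], as [Ex_exp_star] requires. If that norm is
    zero, so are the numerators and the quotients. *)
Definition bad_star o m : R :=
  exp (\Rsum_(j : I) (if adj o m j
          then Rabs (x m o j - ths j) / supnorm (fun j => x m o j - ths j) else 0)
       - 2 * p * \Rsum_(j : I) (Rabs (x m o j - ths j) / supnorm (fun j => x m o j - ths j)))
  * exp (- (8 * ell)).

Lemma Ex_bad_star m : Ex w p (fun o => bad_star o m) <= exp (- (8 * ell)).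
Proof.
rewrite Ex_mulr -[X in _ <= X]Rmult_1_l; apply: Rmult_le_compat_r; first exact/Rlt_le/exp_pos.
pose u o j := Rabs (x m o j - ths j) / supnorm (fun j => x m o j - ths j).
apply: (@Ex_exp_star _ _ _ _ w_gt0 p01 m u) => [o o'|o j].
  by rewrite /u x_resample.
have h1 := supnorm_term (fun j => x m o j - ths j) j; have h2 := Rabs_pos (x m o j - ths j).
rewrite /u; set H := supnorm _ in h1 *.
have [H0 | H0] : H = 0 \/ 0 < H by move: h1 => /=; lra.
  have -> : Rabs (x m o j - ths j) = 0 by move: h1 => /=; lra.
  by rewrite /Rdiv Rmult_0_l; lra.
split; first by apply: Rmult_le_pos => //; apply/Rlt_le/Rinv_0_lt_compat.
by apply: (Rmult_le_reg_r H) => //; rewrite /Rdiv Rmult_assoc Rinv_l; [move: h1 => /=; lra | lra].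
Qed.

Definition badness o : R :=
  \Rsum_(m : I) bad_degree o m + \Rsum_(m : I) \Rsum_(b : bool) bad_noise o m b
  + \Rsum_(i : I) \Rsum_(j : I) \Rsum_(b : bool) bad_edge o i j b
  + \Rsum_(k : option I) \Rsum_(S : {set I} | is_cut k S) bad_cut o S (cut_domain k)
  + \Rsum_(m : I) bad_star o m.

Lemma INR_pow8 : exp (- (8 * ell)) = / INR n ^ 8.
Proof.
by rewrite exp_Ropp -ell_def; congr (/ _); rewrite /= Rmult_1_r -!exp_plus; congr exp; ring.
Qed.

(** With E = n^-8 the five groups contribute n, 2 n, 2 n^2, 2 n (n + 1) and n times E. The total 4
    n^2 + 6 n is at most 7 n^2 for n >= 2, leaving 7 n^-6. *)
Lemma Ex_badness : Ex w p badness <= 7 / INR n ^ 5.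
Proof.
set E := exp (- (8 * ell)); have E0 : 0 < E by apply: exp_pos.
have n2 := le_INR _ _ (elimT leP n_gt1); rewrite /= in n2.
have hn := n_gt0.
have EE : E = / INR n ^ 8 by exact: INR_pow8.
have nE : INR n * E <= 1.
  rewrite EE; have -> : INR n * / INR n ^ 8 = / INR n ^ 7 by field; lra.
  by rewrite -Rinv_1; apply: Rinv_le_contravar; [lra | apply: pow_R1_Rle; lra].
rewrite /badness !Ex_add !Ex_sum.
have d1 (f : I -> R) : (forall i, f i <= E) -> \Rsum_(i : I) f i <= INR n * E.
  have -> : INR n = INR #|I| by rewrite card_ord.
  by move=> h; rewrite -Rsum_constT; apply: Rsum_le => i _.
have d2 (f : bool -> R) : (forall b, f b <= E) -> \Rsum_(b : bool) f b <= 2 * E.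
  by move=> h; rewrite big_bool /=; have := h true; have := h false; lra.
have h1 := d1 _ Ex_bad_degree; have h5 := d1 _ Ex_bad_star.
have h2 : \Rsum_(m : I) Ex w p (fun o => \Rsum_(b : bool) bad_noise o m b) <= INR n * (2 * E).
  have -> : INR n = INR #|I| by rewrite card_ord.
  by rewrite -Rsum_constT; apply: Rsum_le => m _; rewrite Ex_sum; apply: d2 => b; exact: Ex_bad_noise.
have h3 : \Rsum_(i : I) Ex w p (fun o => \Rsum_(j : I) \Rsum_(b : bool) bad_edge o i j b)
    <= INR n * (INR n * (2 * E)).
  have -> : INR n = INR #|I| by rewrite card_ord.
  rewrite -!Rsum_constT; apply: Rsum_le => i _; rewrite Ex_sum; apply: Rsum_le => j _.
  by rewrite Ex_sum; apply: d2 => b; exact: Ex_bad_edge.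
have h4 : \Rsum_(k : option I) Ex w p (fun o => \Rsum_(S : {set I} | is_cut k S)
      bad_cut o S (cut_domain k)) <= (INR n + 1) * (2 * (INR n * E)).
  have -> : INR n + 1 = INR #|{: option I}| by rewrite card_option card_ord S_INR.
  rewrite -Rsum_constT; apply: Rsum_le => k _; rewrite Ex_sum.
  apply: Rle_trans (sum_sets_pow (Rlt_le _ _ E0) nE).
  rewrite [X in X <= _]Rsum_mkcond [X in _ <= X]Rsum_mkcond; apply: Rsum_le => S _.
  have hpow : 0 <= E ^ #|S| by apply: pow_le; lra.
  rewrite /is_cut; case: (S != set0) => /=; last lra.
  case: ifP => [/andP[h1' h2']|_]; last exact: hpow.
  by apply: Ex_bad_cut => //; exact: cut_domain_large.
apply: Rle_trans (Rplus_le_compat _ _ _ _ (Rplus_le_compat _ _ _ _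
  (Rplus_le_compat _ _ _ _ (Rplus_le_compat _ _ _ _ h1 h2) h3) h4) h5) _.
apply: Rle_trans (_ : 7 * (INR n ^ 2 * E) <= _).
  have : INR n * E * 2 <= INR n * E * INR n by apply: Rmult_le_compat_l; [apply: Rmult_le_pos|]; lra.
  by nra.
rewrite EE; have -> : INR n ^ 2 * / INR n ^ 8 = / INR n ^ 6 by field; lra.
apply: Rmult_le_compat_l; first lra.
by apply: Rinv_le_contravar; [apply: pow_lt | apply: Rle_pow; [lra | apply/leP]].
Qed.

End Concentration.

(** * Estimation error on the good event *)

Lemma sum_indic_diff (V : finType) (F : V -> V -> R) (S W : {set V}) :
  (forall i j, F i j = F j i) ->
  \Rsum_(i : V | i \in W) \Rsum_(j : V | j \in W) (F i j * Rabs (indic S i - indic S j)) =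
  2 * \Rsum_(i : V | i \in W :&: S) \Rsum_(j : V | j \in W :\: S) F i j.
Proof.
move=> symF; set X := \Rsum_(i : V | i \in W :&: S) _.
pose G i j := if (i \in S) && (j \notin S) then F i j else 0.
have XG : X = \Rsum_(i : V | i \in W) \Rsum_(j : V | j \in W) G i j.
  rewrite /X [LHS]Rsum_mkcond [RHS]Rsum_mkcond; apply: eq_bigr => i _.
  rewrite inE; case: (i \in W) => //=; rewrite /G; case: (i \in S) => /=; last by rewrite big1.
  rewrite [LHS]Rsum_mkcond [RHS]Rsum_mkcond; apply: eq_bigr => j _; rewrite inE.
  by case: (j \in S); case: (j \in W).
have XG' : X = \Rsum_(i : V | i \in W) \Rsum_(j : V | j \in W) G j i.
  by rewrite XG exchange_big.
have -> : 2 * X = X + X by ring.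
rewrite {1}XG XG' -Rsum_add; apply: eq_bigr => i _; rewrite -Rsum_add; apply: eq_bigr => j _.
rewrite /G /indic (symF j i); case: (i \in S); case: (j \in S) => /=;
  rewrite ?Rminus_diag ?Rminus_0_r ?Rminus_0_l ?Rabs_Ropp ?Rabs_R0 ?Rabs_R1; ring.
Qed.

Lemma lt_of_exp_mul_lt1 (y t : R) : exp y * exp (- t) < 1 -> y < t.
Proof. by rewrite -exp_plus => /exp_lt1_lt0; lra. Qed.

Lemma Rsum_term_lt1 (J : finType) (P : pred J) (F : J -> R) j : (forall j, P j -> 0 <= F j) ->
  \Rsum_(j : J | P j) F j < 1 -> P j -> F j < 1.
Proof. by move=> h0 h1 Pj; apply: Rle_lt_trans (Rsum_term h0 Pj) h1. Qed.

Lemma sum5_terms_lt1 (q1 q2 q3 q4 q5 : R) : 0 <= q1 -> 0 <= q2 -> 0 <= q3 -> 0 <= q4 -> 0 <= q5 ->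
  q1 + q2 + q3 + q4 + q5 < 1 -> [/\ q1 < 1, q2 < 1, q3 < 1, q4 < 1 & q5 < 1].
Proof. by move=> *; split; lra. Qed.

Section Estimation.
Variables (n L : nat) (w : 'I_n -> R) (p ell r B clam T c0 : R) (ths : 'I_n -> R).
Notation outc := (outcome n L).
Implicit Types (o : outc) (i j m : 'I_n).
Let a : R := INR n * p.
Let lam : R := clam * B.
Hypotheses (n_gt1 : (1 < n)%N) (p_gt0 : 0 < p) (p_le1 : p <= 1) (ell_gt0 : 0 < ell) (r_gt0 : 0 < r) (B_gt0 : 0 < B)
  (B_sqr : B ^ 2 = a * r ^ 2) (ell_def : exp ell = INR n)
  (clam_gt0 : 0 < clam) (T_ge0 : 0 <= T) (ths_le : forall i, Rabs (ths i) <= T)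
  (ths_sum : \Rsum_(i : 'I_n) ths i = 0)
  (ths_win_prob : forall i j, sigmoid (ths i - ths j) = win_prob w i j)
  (c0_ge : 256 * (1 + loo_const clam T) / sig_slope (slope_range clam T) <= c0)
  (c0_ge128 : 128 <= c0) (a_ge : c0 * ell <= a).

(** log n >= 1 - 1/n, from the tangent bound for exp at -log n. *)
Lemma ell_ge_half : / 2 <= ell.
Proof.
have n2 := le_INR _ _ (elimT leP n_gt1); rewrite /= in n2.
have h := exp_ge1D (- ell); rewrite exp_Ropp ell_def in h.
have : / INR n <= / 2 by apply: Rinv_le_contravar; lra.
by lra.
Qed.

Lemma a_ge128 : 128 * ell <= a.
Proof. by have h := Rmult_le_compat_r _ _ _ (Rlt_le _ _ ell_gt0) c0_ge128; apply: Rle_trans h a_ge. Qed.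

Variable x : 'I_n -> outc -> 'I_n -> R.
Hypothesis x_spec : forall m o,
  [/\ forall o', x m (resample m o o') = x m o,
      x m o m = ths m,
      \Rsum_(i : 'I_n) x m o i = 0,
      small_noise r B ths o ->
        forall i j, i != m -> j != m -> Rabs (x m o i - x m o j) <= slope_range clam T
    & exists s, forall i, i != m ->
        Rabs (\Rsum_(j : 'I_n | j != m) (if adj o i j
                then sigmoid (x m o i - x m o j) - win_freq o i j else 0)
              + lam * x m o i - s) <= B / INR n].

Variable o : outc.

Lemma bad_degree_ge0 m : 0 <= bad_degree p ell o m.
Proof. by apply: Rmult_le_pos; apply/Rlt_le/exp_pos. Qed.

Lemma bad_noise_ge0 m b : 0 <= bad_noise w ell B o m b.
Proof. by apply: Rmult_le_pos; apply/Rlt_le/exp_pos. Qed.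

Lemma bad_edge_ge0 i j b : 0 <= bad_edge w ell r o i j b.
Proof. by apply: Rmult_le_pos; apply/Rlt_le/exp_pos. Qed.

Lemma bad_cut_ge0 S W : 0 <= bad_cut p o S W.
Proof. by apply: Rmult_le_pos; apply/Rlt_le/exp_pos. Qed.

Lemma bad_star_ge0 m : 0 <= bad_star p ell ths x o m.
Proof. by apply: Rmult_le_pos; apply/Rlt_le/exp_pos. Qed.

Lemma badness_parts :
  [/\ 0 <= \Rsum_(m : 'I_n) bad_degree p ell o m,
      0 <= \Rsum_(m : 'I_n) \Rsum_(b : bool) bad_noise w ell B o m b,
      0 <= \Rsum_(i : 'I_n) \Rsum_(j : 'I_n) \Rsum_(b : bool) bad_edge w ell r o i j b,
      0 <= \Rsum_(k : option 'I_n) \Rsum_(S : {set 'I_n} | is_cut k S) bad_cut p o S (cut_domain k)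
    & 0 <= \Rsum_(m : 'I_n) bad_star p ell ths x o m].
Proof.
split; repeat (apply: Rsum_ge0 => ? _).
- exact: bad_degree_ge0.
- exact: bad_noise_ge0.
- exact: bad_edge_ge0.
- exact: bad_cut_ge0.
- exact: bad_star_ge0.
Qed.

Lemma badness_ge0 : 0 <= badness w p ell r B ths x o.
Proof. by have [h1 h2 h3 h4 h5] := badness_parts; rewrite /badness; lra. Qed.

Hypothesis good : badness w p ell r B ths x o < 1.

Lemma good_degree m : \Rsum_(j : 'I_n) (if adj o m j then 1 else 0) <= 3 * a.
Proof.
have [p1 p2 p3 p4 p5] := badness_parts.
have [h1 h2 h3 h4 h5] := sum5_terms_lt1 p1 p2 p3 p4 p5 good.
have : bad_degree p ell o m < 1.
  by apply: (@Rsum_term_lt1 _ xpredT (bad_degree p ell o)) => // ? _; exact: bad_degree_ge0.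
move/lt_of_exp_mul_lt1; rewrite Rsum_constT card_ord => h.
by have := a_ge128; have := ell_gt0; rewrite /a => g1 g2; apply: Rlt_le; lra.
Qed.

Lemma noise_sumE m : noise (adj o) (win_freq o) ths m = noise_sum w o m.
Proof. by apply: eq_bigr => j _; rewrite ths_win_prob. Qed.

Lemma sign_bound (s y t : R) : 0 < s -> (forall b : bool, (if b then 1 else -1) * (ell / s) * y < t * ell) ->
  Rabs y <= t * s.
Proof.
move=> s0 h; have e : 0 < ell / s by apply: Rdiv_lt_0_compat.
have h1 := h true; have h2 := h false; rewrite /= in h1 h2.
have E : t * ell = ell / s * (t * s) by field; lra.
by apply: Rabs_le; split; apply: Rlt_le; apply: (Rmult_lt_reg_l (ell / s)) => //; lra.
Qed.

Lemma good_noise : small_noise r B ths o.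
Proof.
have [p1 p2 p3 p4 p5] := badness_parts.
have [h1 h2 h3 h4 h5] := sum5_terms_lt1 p1 p2 p3 p4 p5 good.
split=> [m | i j Aij].
  rewrite noise_sumE; apply: sign_bound => // b; apply: lt_of_exp_mul_lt1.
  apply: (@Rsum_term_lt1 _ xpredT (bad_noise w ell B o m)) => // [? _|]; first exact: bad_noise_ge0.
  apply: (@Rsum_term_lt1 _ xpredT (fun m => \Rsum_(b : bool) bad_noise w ell B o m b)) => // ? _.
  by apply: Rsum_ge0 => ? _; exact: bad_noise_ge0.
apply: sign_bound => // b; apply: lt_of_exp_mul_lt1.
have : bad_edge w ell r o i j b < 1.
  apply: (@Rsum_term_lt1 _ xpredT (bad_edge w ell r o i j)) => // [? _|]; first exact: bad_edge_ge0.
  apply: (@Rsum_term_lt1 _ xpredT (fun j => \Rsum_(b : bool) bad_edge w ell r o i j b)) => // [? _|].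
    by apply: Rsum_ge0 => ? _; exact: bad_edge_ge0.
  apply: (@Rsum_term_lt1 _ xpredT (fun i => \Rsum_(j : 'I_n) \Rsum_(b : bool) bad_edge w ell r o i j b)) => // ? _.
  by do 2!(apply: Rsum_ge0 => ? _); exact: bad_edge_ge0.
by rewrite /bad_edge Aij ths_win_prob.
Qed.

Lemma good_cut_half (k : option 'I_n) (S : {set 'I_n}) : S \subset cut_domain k ->
  (2 * #|S| <= #|cut_domain k|)%N ->
  p / 4 * (INR #|S| * INR #|cut_domain k :\: S|) <= cut_size o S (cut_domain k).
Proof.
move=> SW S2; have [S0 | S0] := eqVneq S set0.
  rewrite S0 cards0 Rmult_0_l Rmult_0_r.
  by do 2!(apply: Rsum_ge0 => ? _); case: ifP => _; lra.
have [p1 p2 p3 p4 p5] := badness_parts.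
have [h1 h2 h3 h4 h5] := sum5_terms_lt1 p1 p2 p3 p4 p5 good.
have hk : \Rsum_(S : {set 'I_n} | is_cut k S) bad_cut p o S (cut_domain k) < 1.
  apply: (@Rsum_term_lt1 _ xpredT (fun k => \Rsum_(S : {set 'I_n} | is_cut k S) bad_cut p o S (cut_domain k))) => // ? _.
  by apply: Rsum_ge0 => ? _; exact: bad_cut_ge0.
have := @Rsum_term_lt1 _ (is_cut k) (fun S => bad_cut p o S (cut_domain k)) S (fun S _ => bad_cut_ge0 S _) hk.
rewrite /is_cut S0 SW S2 => /(_ isT); rewrite /bad_cut -exp_plus => /exp_lt1_lt0; lra.
Qed.

(** Both sides depend only on the partition of W by S, so the bound for the smaller of the two parts
    applies. *)
Lemma good_cut (W S : {set 'I_n}) : (n <= #|W|.+1)%N ->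
  p / 4 * (\Rsum_(i : 'I_n | i \in W) \Rsum_(j : 'I_n | j \in W) Rabs (indic S i - indic S j))
  <= \Rsum_(i : 'I_n | i \in W) \Rsum_(j : 'I_n | j \in W)
       (if adj o i j then Rabs (indic S i - indic S j) else 0).
Proof.
move=> /(cut_domainP n_gt1)[k ->]; set W' := cut_domain k.
have -> : \Rsum_(i : 'I_n | i \in W') \Rsum_(j : 'I_n | j \in W') Rabs (indic S i - indic S j) =
    2 * (INR #|W' :&: S| * INR #|W' :\: S|).
  have := @sum_indic_diff _ (fun _ _ => 1) S W' (fun _ _ => erefl _).
  rewrite !Rsum_const_in Rmult_1_r => <-.
  by apply: eq_bigr => i _; apply: eq_bigr => j _; rewrite Rmult_1_l.
have -> : \Rsum_(i : 'I_n | i \in W') \Rsum_(j : 'I_n | j \in W')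
       (if adj o i j then Rabs (indic S i - indic S j) else 0) = 2 * cut_size o (W' :&: S) W'.
  have := @sum_indic_diff _ (fun i j => if adj o i j then 1 else 0) S W'.
  move=> /(_ (fun i j => ltac:(by rewrite adj_sym))) h.
  transitivity (2 * \Rsum_(i : 'I_n | i \in W' :&: S) \Rsum_(j : 'I_n | j \in W' :\: S) (if adj o i j then 1 else 0)).
    by rewrite -h; apply: eq_bigr => i _; apply: eq_bigr => j _; case: ifP => _; rewrite ?Rmult_1_l ?Rmult_0_l.
  rewrite /cut_size; congr (2 * _); apply: eq_bigr => i _; apply: eq_bigl => j.
  by rewrite !inE; case: (j \in W'); case: (j \in S).
have sE := cardsID S W'.
have [le | le] := leqP #|W' :&: S| #|W' :\: S|.
  have := @good_cut_half k (W' :&: S) (subsetIl _ _).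
  have -> : cut_domain k :\: (W' :&: S) = W' :\: S.
    by apply/setP => i; rewrite !inE; case: (i \in W'); case: (i \in S).
  rewrite -/W' => /(_ _) h; have := h ltac:(by rewrite -sE mul2n -addnn leq_add2l).
  by move: (cut_size _ _ _) (INR #|_|) (INR #|_|) => q s t; lra.
have := @good_cut_half k (W' :\: S) (subsetDl _ _).
have -> : cut_domain k :\: (W' :\: S) = W' :&: S.
  by apply/setP => i; rewrite !inE; case: (i \in W'); case: (i \in S).
rewrite -/W' => /(_ _) h; have := h ltac:(by rewrite -sE mul2n -addnn leq_add2r ltnW).
have -> : cut_size o (W' :\: S) W' = cut_size o (W' :&: S) W'.
  rewrite /cut_size exchange_big.
  rewrite (eq_bigl (fun j => j \in W' :&: S)) => [|j]; last by rewrite !inE; case: (j \in W'); case: (j \in S).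
  apply: eq_bigr => i _; rewrite (eq_bigl (fun j => j \in W' :\: (W' :&: S))) => [|j].
    by apply: eq_bigr => j _; rewrite adj_sym.
  by rewrite !inE; case: (j \in W'); case: (j \in S).
by move: (cut_size _ _ _) (INR #|_|) (INR #|_|) => q s t; lra.
Qed.

Lemma good_star m :
  \Rsum_(j : 'I_n) (if adj o m j then Rabs (x m o j - ths j) else 0) <=
  2 * p * (\Rsum_(j : 'I_n) Rabs (x m o j - ths j)) +
  8 * ell * supnorm (fun j => x m o j - ths j).
Proof.
have [p1 p2 p3 p4 p5] := badness_parts.
have [h1 h2 h3 h4 h5] := sum5_terms_lt1 p1 p2 p3 p4 p5 good.
have : bad_star p ell ths x o m < 1.
  by apply: (@Rsum_term_lt1 _ xpredT (bad_star p ell ths x o)) => // ? _; exact: bad_star_ge0.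
move/lt_of_exp_mul_lt1.
set H := supnorm _; have H0 : 0 <= H by apply: supnorm_ge0.
set X1 := \Rsum_(j : 'I_n) _; set X2 := \Rsum_(j : 'I_n) (_ / _) => h.
have hu j : Rabs (x m o j - ths j) = H * (Rabs (x m o j - ths j) / H).
  have [e | e] : H = 0 \/ 0 < H by lra.
    have := supnorm_term (fun j => x m o j - ths j) j; rewrite -/H e => h'.
    by have := Rabs_pos (x m o j - ths j); rewrite Rmult_0_l; lra.
  by field; lra.
have -> : \Rsum_(j : 'I_n) (if adj o m j then Rabs (x m o j - ths j) else 0) = H * X1.
  by rewrite -Rsum_mull; apply: eq_bigr => j _; case: ifP => _; [rewrite -hu | ring].
have -> : \Rsum_(j : 'I_n) Rabs (x m o j - ths j) = H * X2.
  by rewrite -Rsum_mull; apply: eq_bigr => j _; rewrite -hu.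
have := Rmult_le_compat_l _ _ _ H0 (Rlt_le _ _ h); lra.
Qed.

Lemma good_regMLE th i : is_regMLE o lam th -> Rabs (th i - ths i) <= core_const clam T * (B / a).
Proof.
move=> hth; have lam0 : 0 < lam by apply: Rmult_lt_0_compat.
(* This m depends on the outcome and on theta; that is harmless because the bounds on x hold for
   every m. *)
have [m hm] := fin_argmax (fun i => Rabs (th i - ths i)) i.
apply: Rle_trans (hm i) _.
have [_ xm xs xd [s xe]] := x_spec m o; have [gn1 gn2] := good_noise.
have n2 := le_INR _ _ (elimT leP n_gt1); rewrite /= in n2.
have c0p : 0 < c0 by lra.
have e2 := ell_ge_half.
have ac0 : c0 / 2 <= a by have := Rmult_le_compat_l _ _ _ (Rlt_le _ _ c0p) e2; have := a_ge; lra.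
apply: (@sup_error_le n (adj o) (win_freq o) ths th p T clam B r ell c0 n_gt1 p_gt0 p_le1 _
  T_ge0 clam_gt0 B_gt0 B_sqr (adj_sym o) (adj_irr o) ths_le ths_sum good_degree gn1 gn2 _ good_cut
  _ m (x m o) s (B / INR n) _ xm xs (xd good_noise) xe _ hm erefl (Rlt_le _ _ ell_gt0) c0p _ c0_ge
  ac0 (good_star m)).
- by rewrite -/a; lra.
- by move=> k j Akj; apply: win_freqC; apply: contraTneq Akj => ->; rewrite adj_irr.
- by move=> k; exact: (regMLE_stationary k (Rlt_le _ _ lam0) hth).
- have -> : INR n * (B / INR n) ^ 2 = B ^ 2 / INR n by field; lra.
  rewrite -[X in _ <= X]Rmult_1_r; apply: Rmult_le_compat_l; first exact: pow2_ge_0.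
  by rewrite -Rinv_1; apply: Rinv_le_contravar; lra.
- apply: (Rmult_le_reg_r c0) => //; rewrite /Rdiv Rmult_assoc Rinv_l; last lra.
  by rewrite -/a; have := a_ge; lra.
Qed.

End Estimation.

Lemma regMLE_error n L (w : 'I_n -> R) (p ell r B clam T c0 : R) (ths : 'I_n -> R) :
  (1 < n)%N -> (0 < L)%N -> (forall i, 0 < w i) -> 0 < p -> p <= 1 -> 0 < ell -> 0 < r -> 0 < B ->
  INR L * r ^ 2 = ell -> B ^ 2 = INR n * p * r ^ 2 -> exp ell = INR n ->
  0 < clam -> 0 <= T -> (forall i, Rabs (ths i) <= T) -> \Rsum_(i : 'I_n) ths i = 0 ->
  (forall i j, sigmoid (ths i - ths j) = win_prob w i j) ->
  256 * (1 + loo_const clam T) / sig_slope (slope_range clam T) <= c0 -> 128 <= c0 ->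
  c0 * ell <= INR n * p ->
  @prob n L w p (fun o => forall th, is_regMLE o (clam * B) th ->
     forall i, Rabs (th i - ths i) <= core_const clam T * (B / (INR n * p))) >= 1 - 7 / INR n ^ 5.
Proof.
move=> n1 L0 w0 p0 p1 ell0 r0 B0 rE BE nE clam0 T0 thsT ths0 thsw c0h c0128 a0.
have ha := a_ge128 ell0 c0128 a0.
have [x hx] := loo_exists n1 L0 ell0 r0 B0 BE ha nE clam0 thsT.
apply: (prob_ge w0 (conj (Rlt_le _ _ p0) p1) (Z := badness w p ell r B ths x)).
- by move=> o; exact: badness_ge0.
- move=> o good th hth i.
  exact: (good_regMLE n1 p0 p1 ell0 r0 B0 BE nE clam0 T0 thsT ths0 thsw c0h c0128 a0 hx good i hth).
- by apply: Ex_badness => //; [split; lra | move=> m o o'; case: (hx m o)].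
Qed.

(** * Entrywise error of the exponentiated scores *)

Lemma prob_ge0 n L (w : 'I_n -> R) p (E : outcome n L -> Prop) :
  (forall i, 0 < w i) -> 0 <= p <= 1 -> 0 <= prob w p E.
Proof.
move=> w0 p01; apply: Rsum_ge0 => o _; have := weight_ge0 w0 p01 o => h.
by case: (excluded_middle_informative (E o)) => e /=; lra.
Qed.

Lemma prob_mono n L (w : 'I_n -> R) p (E E' : outcome n L -> Prop) :
  (forall i, 0 < w i) -> 0 <= p <= 1 -> (forall o, E o -> E' o) -> prob w p E <= prob w p E'.
Proof.
move=> w0 p01 EE; apply: Rsum_le => o _; have := weight_ge0 w0 p01 o => h.
case: (excluded_middle_informative (E o)) => e /=;
  case: (excluded_middle_informative (E' o)) => e' /=; try lra.
by have := EE o e.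
Qed.

Lemma exp_sub1_le y : Rabs (exp y - 1) <= Rabs y * exp (Rabs y).
Proof.
have h1 := exp_ge1D y; have h2 := exp_ge1D (- y); have h3 := exp_pos y.
case: (Rle_lt_dec 0 y) => hy.
  rewrite (Rabs_right y); last lra; rewrite Rabs_right; last lra.
  have e : exp (- y) * exp y = 1 by rewrite -exp_plus Rplus_opp_l exp_0.
  by nra.
rewrite (Rabs_left y) //; rewrite Rabs_left1.
  by have := exp_ge1D (- y); nra.
have : exp y <= 1 by rewrite -exp_0; apply: exp_monotone; lra.
by lra.
Qed.

(** The factor exp(ths i) in exp(th i) - exp(ths i) = (exp(th i - ths i) - 1) exp(ths i) is at most
    the denominator. *)
Lemma supnorm_exp_ratio n (th ths : 'I_n -> R) e : (0 < n)%N ->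
  (forall i, Rabs (th i - ths i) <= e) ->
  supnorm (fun i => exp (th i) - exp (ths i)) / supnorm (fun i => exp (ths i)) <= e * exp e.
Proof.
case: n th ths => // n th ths _ h; set S := supnorm (fun i => exp (ths i)).
have e0 : 0 <= e by apply: Rle_trans (Rabs_pos _) (h ord0).
have hS i : exp (ths i) <= S.
  by have := supnorm_term (fun i => exp (ths i)) i; rewrite Rabs_right //; apply/Rle_ge/Rlt_le/exp_pos.
have S0 : 0 < S by apply: Rlt_le_trans (exp_pos _) (hS ord0).
have ee : 0 <= e * exp e by apply: Rmult_le_pos => //; exact/Rlt_le/exp_pos.
apply: (Rmult_le_reg_r S) => //; rewrite /Rdiv Rmult_assoc Rinv_l ?Rmult_1_r; last lra.
apply: supnorm_le => [|i]; first by apply: Rmult_le_pos; lra.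
have -> : exp (th i) - exp (ths i) = (exp (th i - ths i) - 1) * exp (ths i).
  have {1}-> : th i = (th i - ths i) + ths i by ring.
  by rewrite exp_plus; ring.
rewrite Rabs_mult (Rabs_right (exp _)); last exact/Rle_ge/Rlt_le/exp_pos.
apply: Rmult_le_compat; [exact: Rabs_pos | exact/Rlt_le/exp_pos | | exact: hS].
apply: Rle_trans (exp_sub1_le _) _; apply: Rmult_le_compat; [exact: Rabs_pos | exact/Rlt_le/exp_pos | exact: h |].
exact/exp_monotone/h.
Qed.

Section CenteredLog.
Variables (n : nat) (w : 'I_n -> R) (wmin wmax : R).
Hypotheses (n_pos : (0 < n)%N) (wmin_gt0 : 0 < wmin) (w_range : forall i, wmin <= w i <= wmax).

Definition centered_log (i : 'I_n) : R := ln (w i) - (\Rsum_(k : 'I_n) ln (w k)) / INR n.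

Lemma centered_log_sum : \Rsum_(i : 'I_n) centered_log i = 0.
Proof.
have hn : 0 < INR n by apply: lt_0_INR; apply/ltP.
by rewrite Rsum_sub Rsum_constT card_ord; set S := (X in X - _ = _); rewrite -/S; field; lra.
Qed.

Lemma centered_log_le i : Rabs (centered_log i) <= ln (wmax / wmin).
Proof.
have hn : 0 < INR n by apply: lt_0_INR; apply/ltP.
have hw k : ln wmin <= ln (w k) <= ln wmax.
  by have := w_range k; split; apply: ln_monotone; lra.
have -> : ln (wmax / wmin) = ln wmax - ln wmin.
  rewrite /Rdiv ln_mult; [|have := w_range i; lra | exact: Rinv_0_lt_compat].
  by rewrite ln_Rinv.
have bound c : (\Rsum_(k : 'I_n) c) / INR n = c by rewrite Rsum_constT card_ord; field; lra.
have lo : ln wmin <= (\Rsum_(k : 'I_n) ln (w k)) / INR n.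
  rewrite -(bound (ln wmin)); apply: Rmult_le_compat_r; first exact/Rlt_le/Rinv_0_lt_compat.
  by apply: Rsum_le => k _; case: (hw k).
have hi : (\Rsum_(k : 'I_n) ln (w k)) / INR n <= ln wmax.
  rewrite -(bound (ln wmax)); apply: Rmult_le_compat_r; first exact/Rlt_le/Rinv_0_lt_compat.
  by apply: Rsum_le => k _; case: (hw k).
by have := hw i; rewrite /centered_log => h; apply: Rabs_le; lra.
Qed.

Lemma sigmoid_centered_log i j : sigmoid (centered_log i - centered_log j) = win_prob w i j.
Proof.
have wi : 0 < w i by have := w_range i; lra.
have wj : 0 < w j by have := w_range j; lra.
have -> : centered_log i - centered_log j = ln (w i) + - ln (w j) by rewrite /centered_log; ring.
by rewrite /sigmoid exp_plus exp_Ropp !exp_ln // /win_prob; field; split; lra.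
Qed.

End CenteredLog.

Lemma core_const_gt0 clam T : 0 < clam -> 0 <= T -> 0 < core_const clam T.
Proof.
move=> c0 T0; have hs := sig_slope_gt0 (slope_range clam T); have cT := Rmult_le_pos _ _ (Rlt_le _ _ c0) T0.
have h1 : 0 < l2_const clam T by apply: Rdiv_lt_0_compat => //; lra.
have h2 : 0 < loo_const clam T.
  have : 0 < 76800 / sig_slope (slope_range clam T) by apply: Rdiv_lt_0_compat => //; lra.
  by rewrite /loo_const; lra.
by apply: Rdiv_lt_0_compat => //; lra.
Qed.

Unset Implicit Arguments.

Theorem theorem4 :
  forall (kappa0 c2 c3 clam : R),
    1 <= kappa0 -> 0 < c2 -> 0 < c3 -> 0 < clam ->
  exists c0 : R, 0 < c0 /\
  exists C : R, 0 < C /\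
  exists C' : R, 0 < C' /\
  forall (n L : nat) (w : 'I_n -> R) (wmin wmax p lam : R),
    (0 < n)%N -> (0 < L)%N ->
    (* scores: ordered, positive, in [wmin, wmax], kappa = wmax/wmin <= kappa0 *)
    0 < wmin -> (forall i : 'I_n, wmin <= w i <= wmax) ->
    (forall i j : 'I_n, (i <= j)%N -> w j <= w i) ->
    wmax / wmin <= kappa0 ->
    0 <= p <= 1 ->
    p >= c0 * ln (INR n) / INR n ->
    INR L <= c2 * Rpower (INR n) c3 ->
    lam = clam * sqrt (INR n * p * ln (INR n) / INR L) ->
    @prob n L w p (fun o =>
      forall theta : 'I_n -> R, is_regMLE o lam theta ->
        supnorm (fun i => exp (theta i) - centered_exp w i)
          / supnorm (centered_exp w)
        <= C * sqrt (ln (INR n) / (INR n * p * INR L)))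
    >= 1 - C' / INR n ^ 5.
Proof.
move=> kappa0 c2 c3 clam k1 _ _ clam0.
have T0 : 0 <= ln kappa0 by rewrite -ln_1; apply: ln_monotone; lra.
set T := ln kappa0 in T0; set K := core_const clam T.
have K0 : 0 < K by exact: core_const_gt0.
(* 128 serves the concentration bounds, the other term the absorption of D. *)
set c0 := Rmax 128 (256 * (1 + loo_const clam T) / sig_slope (slope_range clam T)).
have c0128 : 128 <= c0 by exact: Rmax_l.
exists c0; split; first lra.
(* The error e <= K rho, with rho <= 1 the rate, yields e exp e <= K exp K rho. *)
exists (K * exp K); split; first by apply: Rmult_lt_0_compat => //; exact: exp_pos.
exists 7; split; first lra.
move=> n L w wmin wmax p lam n0 L0 wmin0 hw _ hk p01 hp _ ->.
have w0 i : 0 < w i by have := hw i; lra.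
have prob0 E : 0 <= @prob n L w p E by exact: prob_ge0.
(* For n = 1 the logarithm vanishes, but the claimed lower bound 1 - 7 is negative. *)
have [n1 | n1] := leqP n 1.
  have e : INR n = 1 by case: (n) n0 n1 => [|[|k]].
  by apply: Rle_ge; apply: Rle_trans (prob0 _); rewrite e pow1; lra.
set ell := ln (INR n) in hp *; have hn := le_INR _ _ (elimT leP n1); rewrite /= in hn.
have hL : 0 < INR L by apply: lt_0_INR; apply/ltP.
have ell0 : 0 < ell by rewrite /ell -ln_1; apply: ln_increasing; lra.
have a0 : c0 * ell <= INR n * p.
  have -> : c0 * ell = INR n * (c0 * ell / INR n) by field; lra.
  by apply: Rmult_le_compat_l; lra.
have cl0 : 0 < c0 * ell by apply: Rmult_lt_0_compat; lra.
have p0 : 0 < p by apply: (Rmult_lt_reg_l (INR n)); lra.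
have aL0 : 0 < INR n * p * INR L by apply: Rmult_lt_0_compat; lra.
have rpos : 0 < ell / INR L by apply: Rdiv_lt_0_compat.
have Bpos : 0 < INR n * p * ell / INR L.
  by apply: Rdiv_lt_0_compat => //; apply: Rmult_lt_0_compat; lra.
set B := sqrt (INR n * p * ell / INR L); have B0 : 0 < B by apply: sqrt_lt_R0.
have r2 : sqrt (ell / INR L) ^ 2 = ell / INR L by rewrite pow2_sqrt; lra.
have B2 : B ^ 2 = INR n * p * ell / INR L by rewrite pow2_sqrt; lra.
have rate : sqrt (ell / (INR n * p * INR L)) = B / (INR n * p).
  rewrite -(sqrt_pow2 (B / (INR n * p))); last by apply: Rlt_le; apply: Rdiv_lt_0_compat; lra.
  have -> : (B / (INR n * p)) ^ 2 = B ^ 2 / (INR n * p) ^ 2 by field; lra.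
  by rewrite B2; congr sqrt; field; lra.
have rate1 : sqrt (ell / (INR n * p * INR L)) <= 1.
  rewrite -sqrt_1; apply: sqrt_le_1_alt; apply: (Rmult_le_reg_r (INR n * p * INR L)) => //.
  rewrite /Rdiv Rmult_assoc Rinv_l ?Rmult_1_r ?Rmult_1_l; last lra.
  have L1 := le_INR _ _ (elimT leP L0); rewrite /= in L1.
  have h1 : 128 * ell <= c0 * ell by apply: Rmult_le_compat_r; lra.
  have h2 : INR n * p * 1 <= INR n * p * INR L by apply: Rmult_le_compat_l; lra.
  by lra.
have thsT i : Rabs (centered_log w i) <= T.
  apply: Rle_trans (centered_log_le n0 wmin0 hw i) _; apply: ln_monotone => //.
  by apply: Rdiv_lt_0_compat => //; have := hw i; lra.
have key := regMLE_error n1 L0 w0 p0 (proj2 p01) ell0 (sqrt_lt_R0 _ rpos) B0 _ _ _ clam0 T0 thsT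
  (centered_log_sum w n0) (sigmoid_centered_log wmin0 hw) (Rmax_r _ _) c0128 a0.
apply: Rge_trans (key _ _ _).
- apply: Rle_ge; apply: prob_mono => // o ho theta /ho hth.
  apply: Rle_trans (supnorm_exp_ratio n0 hth) _.
  rewrite rate -/K; set rho := B / (INR n * p).
  have rho0 : 0 < rho by apply: Rdiv_lt_0_compat; lra.
  have Krho : K * rho <= K.
    by rewrite -[X in _ <= X]Rmult_1_r; apply: Rmult_le_compat_l; [lra | rewrite /rho -rate].
  have := exp_monotone Krho => he.
  have := Rmult_le_compat_l (K * rho) _ _ ltac:(apply: Rmult_le_pos; lra) he; lra.
- by rewrite r2; field; lra.
- by rewrite r2 B2; field; lra.
- by rewrite exp_ln; lra.
Qed.
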